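(* Let $f$ be a weakly biased random multiplicative function. If almost surely $M_f(x)=o(x^{1-\delta})$ for some (possibly random) $0<\delta<1/2$, then there exists $0<\alpha<1/2$ such that the random series $\sum_{p\in\mathcal{P}}\frac{f(p)}{p^{1-\alpha}}$ converges almost surely.
   Context: $\mathcal{P}$ denotes the set of primes and $\mu$ the Möbius function. A random multiplicative function is a random function $f:\mathbb{N}\times\Omega\to\{-1,0,1\}$ with $f(1)=1$, $f(n)=|\mu(n)|\prod_{p\mid n}f(p)$ for $n\ge2$, where $\{f(p)\}_{p\in\mathcal{P}}$ are independent $\pm1$-valued random variables. $f$ is biased if $\mathbb{E} f(p)<0$ for all primes $p$; it is weakly biased if it is biased and $\sum_{p\in\mathcal{P}} f(p)/p$ converges almost surely. $M_f(x):=\sum_{n\le x}f(n)$. *)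

(* Defs.v *)
From HB Require Import structures.
From mathcomp Require Import all_boot all_order all_algebra.
From mathcomp Require Import finmap.
From mathcomp Require Import all_classical all_reals all_analysis.

Set Implicit Arguments.
Unset Strict Implicit.
Unset Printing Implicit Defensive.

Import Order.TTheory GRing.Theory Num.Theory.
Import numFieldNormedType.Exports.

Local Open Scope classical_set_scope.
Local Open Scope ring_scope.

(* Lets the Landau notation =o_F be used with the filter +oo. *)
Canonical pinfty_filter_on (R : numFieldType) : filter_on R :=
  FilterType (pinfty_nbhs R) _.

Definition squarefree (n : nat) : bool :=
  (0 < n)%N && all (fun p => logn p n == 1%N) (primes n).

Definition moebius (n : nat) : int :=
  if squarefree n then (-1) ^+ size (primes n) else 0.

Definition mutually_independent (d : measure_display) (T : measurableType d)
    (R : realType) (P : probability T R) (I : choiceType) (A : set I)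
    (X : I -> {RV P >-> R}) : Prop :=
  forall (J : {fset I}) (B : I -> set R),
    [set` J] `<=` A ->
    (forall i, i \in J -> measurable (B i)) ->
    P (\bigcap_(i in [set` J]) (X i @^-1` B i))
    = (\prod_(i <- J) P (X i @^-1` B i))%E.

(* The positive integers are the intended domain: f 0 is an unconstrained dummy
   value, used nowhere below. *)
Record random_multiplicative (d : measure_display) (T : measurableType d)
    (R : realType) (P : probability T R) (f : nat -> {RV P >-> R}) : Prop := {
  rm_range : forall (n : nat) (w : T),
    (0 < n)%N -> [\/ f n w = -1, f n w = 0 | f n w = 1];
  rm_1 : forall w : T, f 1%N w = 1;
  rm_mult : forall (n : nat) (w : T), (2 <= n)%N ->
    f n w = `|moebius n|%:~R * \prod_(p <- primes n) f p w;
  rm_prime : forall (p : nat) (w : T), prime p -> f p w = -1 \/ f p w = 1;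
  rm_indep : mutually_independent [set p : nat | prime p] f
}.

Definition biased (d : measure_display) (T : measurableType d)
    (R : realType) (P : probability T R) (f : nat -> {RV P >-> R}) : Prop :=
  forall p : nat, prime p -> ('E_P[f p] < 0)%E.

(* Convergence of the partial sums \sum_(p < N, p prime) u p, i.e. of the series
   over the primes taken in increasing order; not absolute convergence. *)
Definition prime_series_cvg (R : realType) (u : nat -> R) : Prop :=
  cvgn (series (fun n : nat => if prime n then u n else 0)).

Definition weakly_biased (d : measure_display) (T : measurableType d)
    (R : realType) (P : probability T R) (f : nat -> {RV P >-> R}) : Prop :=
  biased f /\
  {ae P, forall w, prime_series_cvg (fun p : nat => f p w / p%:R)}.

Definition partial_sum (d : measure_display) (T : measurableType d)
    (R : realType) (P : probability T R) (f : nat -> {RV P >-> R})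
    (w : T) (x : R) : R :=
  \sum_(1 <= n < (Num.truncn x).+1) f n w.

(* Main.v *)
Require Import Defs.
From HB Require Import structures.
From mathcomp Require Import all_boot all_order all_algebra.
From mathcomp Require Import finmap.
From mathcomp Require Import all_classical all_reals all_analysis.
From mathcomp Require Import measurable_realfun ring lra zify.
Import Order.TTheory GRing.Theory Num.Theory.
Import numFieldNormedType.Exports.
Local Open Scope classical_set_scope.
Local Open Scope ring_scope.

Set Implicit Arguments.
Unset Strict Implicit.
Unset Printing Implicit Defensive.

(* Write [e p = E f(p) <= 0].  The [f p - e p] are bounded and uncorrelated, so
   Chebyshev's inequality along fourth powers gives, almost surely,
   [sum_(p <= n) (f p - e p) = O(n ^ (3/4))], and by partial summation
   [sum (f p - e p) p ^ (- s)] converges for [s > 3/4].  It remains to find one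
   [s < 1] at which the deterministic series [sum e p p ^ (- s)] converges, and
   for this a single sample point is enough.

   There the hypothesis on the partial sums makes [F(s) = sum f(n) n ^ (- s)]
   analytic around [s = 1], while the convergence of [sum f(p) / p] and the Euler
   product bound [F(a)] away from [0] as [a] decreases to [1].  Hence [F' / F],
   and with it [sum e p ln p p ^ (- s)], is analytic around [1]; as its
   coefficients have constant sign, Landau's theorem pushes the convergence to
   the left of [1].  Everything is done with real [a > 1]: analyticity is encoded
   by bounds on the Taylor coefficients at [a] in the submultiplicative norm
   [sum |u k| r ^ k], uniform in [a], so no complex variable is needed. *)

(** * Truncated weighted norms of coefficient sequences *)

Section WeightedNorm.
Variable R : realType.
Implicit Types (r x y c : R) (u v : nat -> R).

(** The truncation at [K] keeps every estimate a finite sum; bounds uniform in [K] take the place of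
    absolute convergence at radius [r]. *)
Definition wnorm r (K : nat) u : R := \sum_(k < K) `|u k| * r ^+ k.

Definition cauchy_prod u v : nat -> R :=
  fun k => \sum_(j < k.+1) u j * v (k - j)%N.

Lemma wnorm_ge0 r K u : 0 <= r -> 0 <= wnorm r K u.
Proof.
by move=> r0; apply: sumr_ge0 => k _; rewrite mulr_ge0 ?exprn_ge0.
Qed.

Lemma eq_wnorm r K u v : u =1 v -> wnorm r K u = wnorm r K v.
Proof. by move=> uv; apply: eq_bigr => k _; rewrite uv. Qed.

Lemma wnormD r K u v : 0 <= r ->
  wnorm r K (fun k => u k + v k) <= wnorm r K u + wnorm r K v.
Proof.
move=> r0; rewrite -big_split/=; apply: ler_sum => k _.
by rewrite -mulrDl ler_wpM2r ?exprn_ge0 ?ler_normD.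
Qed.

Lemma wnormN r K u : wnorm r K (fun k => - u k) = wnorm r K u.
Proof. by apply: eq_bigr => k _; rewrite normrN. Qed.

Lemma wnormZ r K u c : wnorm r K (fun k => c * u k) = `|c| * wnorm r K u.
Proof. by rewrite mulr_sumr; apply: eq_bigr => k _; rewrite normrM mulrA. Qed.

Lemma wnorm_sum r K (I : Type) (s : seq I) (P : pred I) (w : I -> nat -> R) :
  0 <= r ->
  wnorm r K (fun k => \sum_(i <- s | P i) w i k)
    <= \sum_(i <- s | P i) wnorm r K (w i).
Proof.
move=> r0; rewrite exchange_big/=; apply: ler_sum => k _.
by rewrite -mulr_suml ler_wpM2r ?exprn_ge0 ?ler_norm_sum.
Qed.

(** The pairs [(j, k - j)] with [k < K] form a triangle in the square of side [K], and the remaining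
    terms of the square are nonnegative. *)
Lemma wnorm_cauchy_prod r K u v : 0 <= r ->
  wnorm r K (cauchy_prod u v) <= wnorm r K u * wnorm r K v.
Proof.
move=> r0.
pose x k := `|u k| * r ^+ k; pose y k := `|v k| * r ^+ k.
have x0 k : 0 <= x k by rewrite mulr_ge0 ?exprn_ge0.
have y0 k : 0 <= y k by rewrite mulr_ge0 ?exprn_ge0.
apply: (@le_trans _ _ (\sum_(0 <= k < K) \sum_(0 <= j < k.+1) x j * y (k - j)%N)).
  rewrite big_mkord; apply: ler_sum => k _.
  rewrite /cauchy_prod big_mkord (le_trans (ler_wpM2r _ (ler_norm_sum _ _ _)))//.
    by rewrite exprn_ge0.
  rewrite mulr_suml; apply: ler_sum => j _.
  rewrite normrM mulrACA -exprD subnKC//.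
  by rewrite -ltnS.
rewrite /wnorm -!(big_mkord xpredT (fun k => `|_ k| * r ^+ k)) mulr_suml.
have -> : \sum_(0 <= k < K) \sum_(0 <= j < k.+1) x j * y (k - j)%N =
    \sum_(0 <= k < K) \sum_(0 <= j < K | (j < k.+1)%N) x j * y (k - j)%N.
  by apply: eq_big_nat => k /andP[_ kK]; rewrite (big_nat_widen _ _ K).
rewrite (exchange_big_dep_nat xpredT)//=.
rewrite big_nat [leRHS]big_nat; apply: ler_sum => j /andP[_ jK].
rewrite -mulr_sumr ler_wpM2l//.
have -> : \sum_(0 <= k < K | (j < k.+1)%N) y (k - j)%N
        = \sum_(j <= k < K) y (k - j)%N.
  rewrite (big_cat_nat (n := j)) ?(ltnW jK)//= big_nat_cond big_pred0 ?add0r; last first.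
    by move=> k; lia.
  by rewrite big_nat_cond [RHS]big_nat_cond; apply: eq_bigl => k; lia.
rewrite -{1}(add0n j) big_addn; under eq_bigr do rewrite addnK.
rewrite [leRHS](big_cat_nat (n := (K - j)%N)) ?leq_subr//=.
by rewrite lerDl; apply: sumr_ge0 => i _; exact: y0.
Qed.

(** For [x <= y] all coefficient differences are nonnegative, so the norm is a partial sum of a
    nondecreasing series whose sum is the right-hand side. *)
Lemma wnorm_exp_coeffB r x y K : 0 <= r -> 0 <= x <= y ->
  wnorm r K (fun k => exp_coeff y k - exp_coeff x k)
    <= expR (r * y) - expR (r * x).
Proof.
move=> r0 /andP[x0 xy].
have y0 : 0 <= y by exact: le_trans xy.
pose s := series (fun k => exp_coeff (r * y) k - exp_coeff (r * x) k).
have sE : s = series (exp_coeff (r * y)) - series (exp_coeff (r * x)).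
  apply/funext => n; rewrite /s /series/= sumrB//.
have cs : s @ \oo --> expR (r * y) - expR (r * x).
  by rewrite sE; apply: cvgB; exact: is_cvg_series_exp_coeff.
have tge0 k : 0 <= exp_coeff (r * y) k - exp_coeff (r * x) k.
  rewrite /exp_coeff/= subr_ge0 ler_wpM2r ?invr_ge0//.
  by apply: lerXn2r; rewrite ?nnegrE ?mulr_ge0// ler_wpM2l.
have -> : wnorm r K (fun k => exp_coeff y k - exp_coeff x k) = s K.
  rewrite /s /series/= big_mkord; apply: eq_bigr => k _.
  rewrite ger0_norm; last first.
    by rewrite /exp_coeff/= subr_ge0 ler_wpM2r ?invr_ge0// lerXn2r ?nnegrE.
  by rewrite /exp_coeff/= mulrBl !exprMn; congr (_ - _); ring.
rewrite -(cvg_lim _ cs)//; apply: nondecreasing_cvgn_le.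
  exact: nondecreasing_series.
by apply/cvg_ex; exists (expR (r * y) - expR (r * x)).
Qed.

Lemma wnorm_exp_coeff r x K : 0 <= r -> 0 <= x ->
  wnorm r K (exp_coeff x) <= expR (r * x).
Proof.
move=> r0 x0.
have cs : series (exp_coeff (r * x)) @ \oo --> expR (r * x).
  exact: is_cvg_series_exp_coeff.
have -> : wnorm r K (exp_coeff x) = series (exp_coeff (r * x)) K.
  rewrite /series/= big_mkord; apply: eq_bigr => k _.
  by rewrite ger0_norm ?exp_coeff_ge0// /exp_coeff/= exprMn; ring.
rewrite -(cvg_lim _ cs)//; apply: nondecreasing_cvgn_le.
  by apply: nondecreasing_series => k _ _; apply: exp_coeff_ge0; rewrite mulr_ge0.
by apply/cvg_ex; exists (expR (r * x)).
Qed.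

Lemma exp_coeffD x y : exp_coeff (x + y) =1 cauchy_prod (exp_coeff x) (exp_coeff y).
Proof.
move=> k; rewrite /exp_coeff/cauchy_prod/= addrC exprDn mulr_suml.
apply: eq_bigr => -[j /=]; rewrite ltnS => jk _.
rewrite -mulr_natr -(bin_fact jk) !natrM.
have j0 : (j`!%:R : R) != 0 by rewrite pnatr_eq0 -lt0n fact_gt0.
have i0 : ((k - j)`!%:R : R) != 0 by rewrite pnatr_eq0 -lt0n fact_gt0.
have b0 : ('C(k, j)%:R : R) != 0 by rewrite pnatr_eq0 -lt0n bin_gt0.
by field; rewrite j0 i0 b0.
Qed.

Lemma exp_coeffS x k : x * exp_coeff x k = k.+1%:R * exp_coeff x k.+1.
Proof.
rewrite /exp_coeff/= factS natrM exprS.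
have k0 : (k`!%:R : R) != 0 by rewrite pnatr_eq0 -lt0n fact_gt0.
have k1 : (k.+1%:R : R) != 0 by rewrite pnatr_eq0.
by field; rewrite k0 nat1r k1.
Qed.

(* Since [k + 1 <= 2 ^ (k + 1)], formal differentiation costs a factor [2] in
   the radius. *)
Lemma wnorm_diff r K u : 0 < r ->
  wnorm r K (fun k => k.+1%:R * u k.+1) <= wnorm (2 * r) K.+1 u / r.
Proof.
move=> r0; rewrite ler_pdivlMr// /wnorm big_ord_recl/=.
rewrite -[leLHS]add0r; apply: lerD; first by rewrite mulr1.
rewrite mulr_suml; apply: ler_sum => k _.
rewrite normrM (ger0_norm (ler0n _ _)) /bump/= add1n exprMn.
rewrite [leLHS](_ : _ = k.+1%:R * (`|u k.+1| * r ^+ k.+1)); last by rewrite exprS; ring.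
rewrite [leRHS](_ : _ = 2 ^+ k.+1 * (`|u k.+1| * r ^+ k.+1)); last by ring.
rewrite ler_wpM2r ?mulr_ge0 ?exprn_ge0 ?(ltW r0)//.
by rewrite -natrX ler_nat ltnW// ltn_expl.
Qed.

(** Past the constant term, [r ^ k] is at most [r / s] times [s ^ k]. Shrinking the radius thus
    makes the nonconstant part small. *)
Lemma wnorm_tail r s K u : 0 <= r -> r <= s -> 0 < s ->
  wnorm r K u - `|u 0%N| <= r / s * wnorm s K u.
Proof.
move=> r0 rs s0; case: K => [|K].
  by rewrite /wnorm !big_ord0 mulr0 sub0r oppr_le0.
rewrite /wnorm !big_ord_recl/= !expr0 !mulr1 addrAC subrr add0r mulrDr.
rewrite -[leLHS]add0r; apply: lerD; first by rewrite mulr_ge0 ?divr_ge0 ?(ltW s0).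
rewrite mulr_sumr; apply: ler_sum => k _.
rewrite mulrCA ler_wpM2l// /bump/= add1n !exprS mulrA divfK ?gt_eqF//.
by rewrite ler_wpM2l// lerXn2r ?nnegrE// ltW.
Qed.

(* The coefficients of [u] are recovered from those of [cauchy_prod u v] as soon as
   the constant term of [v] dominates the rest of [v]. *)
Lemma wnorm_cauchy_prod_div r K u v c : 0 <= r -> 0 < c -> c <= `|v 0%N| ->
  wnorm r K v - `|v 0%N| <= c / 2 -> wnorm r K u <= 2 / c * wnorm r K (cauchy_prod u v).
Proof.
move=> r0 c0 cv vt.
case: K vt => [|K] vt; first by rewrite /wnorm !big_ord0 mulr0.
(* With the constant term of [v] removed, [v 0 * u] is the difference of two products with [u]; the
   one with [v'] costs at most [c / 2] times the norm of [u] and is absorbed on the left. *)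
pose v' k := if k == 0%N then 0 else v k.
have E k : v 0%N * u k = cauchy_prod u v k + - cauchy_prod u v' k.
  rewrite /cauchy_prod -sumrB big_ord_recr/= subnn /v' eqxx mulr0 subr0 mulrC.
  rewrite big1 ?add0r// => j _; case: ifPn => [|_]; last by rewrite subrr.
  by rewrite subn_eq0 leqNgt ltn_ord.
have Nv' : wnorm r K.+1 v' = wnorm r K.+1 v - `|v 0%N|.
  rewrite /wnorm !big_ord_recl/= !expr0 !mulr1 addrAC subrr add0r.
  by rewrite /v' eqxx normr0 add0r.
have : wnorm r K.+1 (fun k => v 0%N * u k) <=
    wnorm r K.+1 (cauchy_prod u v) + wnorm r K.+1 u * (c / 2).
  rewrite (eq_wnorm _ _ E) (le_trans (wnormD _ _ _ r0))// lerD2l wnormN.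
  rewrite (le_trans (wnorm_cauchy_prod _ _ _ r0))// ler_wpM2l ?wnorm_ge0//.
  by rewrite Nv'.
rewrite wnormZ => H.
have H2 := ler_wpM2r (wnorm_ge0 K.+1 u r0) cv.
have := le_trans H2 H.
rewrite [2 / c * _]mulrAC ler_pdivlMr//.
have := wnorm_ge0 K.+1 u r0; move: (wnorm r K.+1 u) (wnorm _ _ (cauchy_prod _ _)) => *.
lra.
Qed.

Lemma wnorm_le (r s : R) K u : 0 <= r <= s -> wnorm r K u <= wnorm s K u.
Proof.
move=> /andP[r0 rs]; apply: ler_sum => k _; rewrite ler_wpM2l//.
by rewrite lerXn2r ?nnegrE// (le_trans r0).
Qed.

End WeightedNorm.

(** * Real powers of integers and partial summation *)

Section RealPowers.
Variable R : realType.
Implicit Types (r s t a d C : R) (u b : nat -> R).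

Lemma lt0_natr (n : nat) : (0 < n)%N -> (0 : R) < n%:R.
Proof. by rewrite ltr0n. Qed.

Lemma le1_natr (n : nat) : (0 < n)%N -> (1 : R) <= n%:R.
Proof. by rewrite ler1n. Qed.

Lemma powR_natE n s : (0 < n)%N -> n%:R `^ s = expR (s * ln n%:R) :> R.
Proof. by move=> n0; rewrite /powR pnatr_eq0 gtn_eqF. Qed.

Lemma powR_natD n s t : (0 < n)%N -> n%:R `^ (s + t) = n%:R `^ s * n%:R `^ t :> R.
Proof. by move=> n0; rewrite !powR_natE// -expRD mulrDl. Qed.

Lemma ler_powR_nat n s t : (0 < n)%N -> s <= t -> n%:R `^ s <= n%:R `^ t :> R.
Proof. by move=> n0; apply: ler_powR; exact: le1_natr. Qed.

Lemma powR_nat_le1 n s : (0 < n)%N -> s <= 0 -> n%:R `^ s <= 1 :> R.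
Proof. by move=> n0 s0; rewrite -[leRHS](powRr0 n%:R) ler_powR_nat. Qed.

Lemma ln_nat_ge0 n : 0 <= ln n%:R :> R.
Proof.
case: n => [|n]; last by rewrite ln_ge0// ler1n.
by rewrite ln0.
Qed.

Lemma ln_succ_sub n : (0 < n)%N -> ln n.+1%:R - ln n%:R <= n%:R^-1 :> R.
Proof.
move=> n0; have n0' := lt0_natr n0.
rewrite -ln_div ?posrE ?ltr0n//.
have -> : n.+1%:R / n%:R = 1 + n%:R^-1 :> R.
  by rewrite -natr1 mulrDl divff ?gt_eqF// mul1r.
by apply: le_ln1Dx; rewrite (lt_trans (ltrN10 _))// invr_gt0.
Qed.

Lemma ln_sub_succ n : (0 < n)%N -> n.+1%:R^-1 <= ln n.+1%:R - ln n%:R :> R.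
Proof.
move=> n0; have n0' := lt0_natr n0.
rewrite -[leRHS]opprB lerNr -ln_div ?posrE ?ltr0n//.
have n1 : n.+1%:R != 0 :> R by rewrite pnatr_eq0.
have -> : n%:R / n.+1%:R = 1 + - n.+1%:R^-1 :> R.
  by field.
by apply: le_ln1Dx; rewrite ltrN2 invf_lt1 ?ltr0n// ltr1n.
Qed.

Lemma powR_succ_le n r : (0 < n)%N -> 0 <= r <= 1 ->
  n.+1%:R `^ r <= n%:R `^ r * (1 + n%:R^-1) :> R.
Proof.
move=> n0 /andP[r0 r1]; have n0' := lt0_natr n0.
have -> : n.+1%:R = n%:R * (1 + n%:R^-1) :> R.
  by rewrite mulrDr mulr1 divff ?gt_eqF// natr1.
have h : 0 <= n%:R^-1 :> R by rewrite invr_ge0.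
rewrite powRM ?addr_ge0// ler_wpM2l ?powR_ge0// ler1_powR// lerDl//.
Qed.

Lemma powR_pred_sub n s : (0 < n)%N -> 0 <= s ->
  n%:R `^ (- s) - n.+1%:R `^ (- s) <= s * n%:R `^ (- s - 1) :> R.
Proof.
move=> n0 s0; have n0' := lt0_natr n0.
rewrite powR_natD// powR_inv1// lerBlDr -lerBlDl !powR_natE//.
rewrite [leLHS](_ : _ = expR (- s * ln n%:R) * (1 - s * n%:R^-1)); last by ring.
rewrite [- s * ln n.+1%:R](_ : _ = - s * ln n%:R + - s * (ln n.+1%:R - ln n%:R)); last by ring.
rewrite expRD ler_wpM2l ?expR_ge0// (le_trans _ (expR_ge1Dx _))//.
by rewrite mulNr lerD2l lerN2 ler_wpM2l// ln_succ_sub.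
Qed.

Lemma powR_succ_leN n s : (0 < n)%N -> 0 <= s -> n.+1%:R `^ (- s) <= n%:R `^ (- s) :> R.
Proof.
move=> n0 s0; rewrite !powR_natE// ler_expR !mulNr lerN2 ler_wpM2l//.
by rewrite ler_ln ?posrE ?ltr0n// ler_nat.
Qed.

(** Integral comparison in telescoping form: for [n >= 2] the term is at most
    [((n - 1) ^ (- t) - n ^ (- t)) / t], and the induction carries the subtracted remainder. The
    term at [0] vanishes and the term at [1] gives the [1]. *)
Lemma series_powR_le t (N : nat) : 0 < t ->
  series (fun n => n%:R `^ (- 1 - t)) N <= 1 + t^-1 :> R.
Proof.
move=> t0.
have z : (0%:R : R) `^ (-1 - t) = 0 by rewrite powR0// lt_eqF//; lra.
have ti : 0 < t^-1 by rewrite invr_gt0.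
suff H n : series (fun n => n%:R `^ (- 1 - t)) n.+2 <= 1 + t^-1 - n.+1%:R `^ (- t) / t :> R.
  case: N => [|[|N]].
  - by rewrite /series/= big_geq//; lra.
  - by rewrite /series/= big_nat1 z; lra.
  - by rewrite (le_trans (H N))// lerBlDr lerDl divr_ge0 ?powR_ge0 ?ltW.
elim: n => [|n IH].
  by rewrite /series/= !big_nat_recr//= big_geq// z !powR1 mul1r addrK !add0r.
rewrite seriesSr (le_trans (lerD IH (lexx _)))//.
suff : n.+2%:R `^ (- 1 - t) <= (n.+1%:R `^ (- t) - n.+2%:R `^ (- t)) / t :> R.
  by rewrite mulrBl; move: (_ / t) (_ / t) => *; lra.
rewrite ler_pdivlMr// addrC powR_natD// powR_inv1// lerBrDr.
rewrite [leLHS](_ : _ = n.+2%:R `^ (- t) * (1 + t * n.+2%:R^-1)); last by ring.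
rewrite !powR_natE//.
have -> : - t * ln n.+1%:R = - t * ln n.+2%:R + t * (ln n.+2%:R - ln n.+1%:R) by ring.
rewrite expRD ler_wpM2l ?expR_ge0// (le_trans _ (expR_ge1Dx _))//.
by rewrite lerD2l ler_wpM2l ?ln_sub_succ// ltW.
Qed.

Lemma is_cvg_series_powR t : 0 < t -> cvgn (series (fun n => n%:R `^ (- 1 - t) : R)).
Proof.
move=> t0; apply: nondecreasing_is_cvgn.
  by apply: nondecreasing_series => n _ _; exact: powR_ge0.
by exists (1 + t^-1) => _ [n _ <-]; exact: series_powR_le.
Qed.

Lemma cvg_powRN t : 0 < t -> (fun n => n%:R `^ (- t) : R) @ \oo --> 0.
Proof.
move=> t0; apply/cvgrPdist_lt => e e0.
near=> n.
have n0 : (0 < n)%N by near: n; exact: nbhs_infty_gt.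
rewrite sub0r normrN ger0_norm ?powR_ge0// powRN invf_plt ?posrE ?powR_gt0 ?lt0_natr//.
have -> : e^-1 = (e^-1 `^ t^-1) `^ t.
  by rewrite -powRrM mulVf ?gt_eqF// powRr1// invr_ge0 ltW.
rewrite gt0_ltr_powR ?nnegrE ?powR_ge0//.
by near: n; exact: nbhs_infty_gtr.
Unshelve. all: by end_near. Qed.

Lemma abel_summation u b (X : nat) :
  series (fun n => u n * b n) X =
  series u X * b X + series (fun n => series u n.+1 * (b n - b n.+1)) X.
Proof.
elim: X => [|X IH]; first by rewrite /series/= !big_geq// mul0r addr0.
by rewrite seriesSr IH [X in _ = _ + X]seriesSr (seriesSr u); ring.
Qed.

(** Partial sums of size [n ^ (1 - d)] meet increments of size [s * n ^ (- s - 1)], and the product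
    is summable exactly because [s > 1 - d]. *)
Lemma abel_cvg u C d s : 0 < d < 1 -> 1 - d < s ->
  (forall n, `|series u n.+1| <= C * n%:R `^ (1 - d)) ->
  cvgn (series (fun n => u n * n%:R `^ (- s))).
Proof.
move=> /andP[d0 d1] ds uC.
have s0 : 0 < s by lra.
have C0 : 0 <= C by have := uC 1%N; rewrite powR1 mulr1; exact: le_trans.
have -> : series (fun n => u n * n%:R `^ (- s)) =
  (fun X => series u X * X%:R `^ (- s)) +
  series (fun n => series u n.+1 * (n%:R `^ (- s) - n.+1%:R `^ (- s))).
  by apply/funext => X; rewrite abel_summation.
apply: is_cvgD.
- apply/cvg_ex; exists 0.
  rewrite -(@cvg_shiftS R).
  apply: (@squeeze_cvgr _ _ _ _ (fun n => - (C * n.+1%:R `^ (- (s - (1 - d)))))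
                                (fun n => C * n.+1%:R `^ (- (s - (1 - d))))).
  + near=> n; rewrite -ler_norml normrM (ger0_norm (powR_ge0 _ _)).
    rewrite opprB powR_natD// mulrA ler_wpM2r ?powR_ge0//.
    rewrite (le_trans (uC n))// ler_wpM2l// ge0_ler_powR// ?nnegrE//.
      by lra.
    by rewrite ler_nat.
  + rewrite -oppr0; apply: cvgN; rewrite -(mulr0 C); apply: cvgMr.
    rewrite (@cvg_shiftS R (fun n => n%:R `^ _)); apply: cvg_powRN; lra.
  + rewrite -(mulr0 C); apply: cvgMr.
    rewrite (@cvg_shiftS R (fun n => n%:R `^ _)); apply: cvg_powRN; lra.
- apply: normed_cvg.
  apply: (@series_le_cvg _ _ (fun n => (C * s) * n%:R `^ (- 1 - (s - (1 - d))))).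
  + by move=> n /=.
  + by move=> n; rewrite mulr_ge0 ?powR_ge0// mulr_ge0// ltW.
  + case=> [|n].
      (* The hypothesis at [n = 0] forces [u 0 = 0], since zero to the nonzero power [1 - d] is
         zero. *)
      rewrite /= normrM (le_trans (ler_wpM2r _ (uC 0%N)))//.
      have e0 : 1 - d != 0 by rewrite gt_eqF//; lra.
      by rewrite (powR0 e0) mulr0 mul0r mulr_ge0 ?powR_ge0// mulr_ge0// ltW.
    rewrite /= normrM.
    apply: (@le_trans _ _ (C * n.+1%:R `^ (1 - d) * (s * n.+1%:R `^ (- s - 1)))).
      rewrite ler_pM// ?uC// ger0_norm ?subr_ge0 ?powR_succ_leN ?(ltW s0)//.
      by rewrite powR_pred_sub// ltW.
    by rewrite mulrACA -powR_natD// ler_wpM2l ?mulr_ge0 ?(ltW s0)// ler_powR_nat//; lra.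
  + by apply: is_cvg_seriesZ; apply: is_cvg_series_powR; lra.
Unshelve. all: by end_near. Qed.

(** Serves as contraction ratio in the recursion over the multiples of a prime; [3 / 4] is large
    enough because [9 / 16 > 1 / 2]. *)
Lemma powR2_le s : 2^-1 <= s -> 2 `^ (- s) <= 3 / 4 :> R.
Proof.
move=> s2; apply: (@le_trans _ _ (2 `^ (- 2^-1))).
  by apply: (@ler_powR_nat 2) => //; lra.
set y := _ `^ _; have y0 : 0 <= y by exact: powR_ge0.
have yy : y * y = 2^-1.
  rewrite /y -(@powR_natD 2)//.
  by rewrite (_ : - 2^-1 - 2^-1 = - 1 :> R) ?powR_inv1//; lra.
nra.
Qed.

Lemma ln_le_powR n : (0 < n)%N -> ln n%:R <= 4 * n%:R `^ 4^-1 :> R.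
Proof.
move=> n0; have := ln_sublinear (powR_gt0 4^-1 (lt0_natr n0)).
rewrite ln_powR => h; have := ltW h; lra.
Qed.

(** Lower bound for an Euler factor: [1 - y <= exp (- y)] at [y = x / (1 + x)] gives
    [exp y <= 1 + x], and [x - 2 x ^ 2 <= y] as long as [x >= - 1 / 2]. *)
Lemma expR_le1Dx (x : R) : `|x| <= 2^-1 -> expR (x - 2 * (x * x)) <= 1 + x.
Proof.
rewrite ler_norml => /andP[x1 x2].
have y0 : 0 < 1 + x by lra.
have yn : 1 + x != 0 by rewrite gt_eqF.
have h := expR_ge1Dx (- (x / (1 + x))).
have {h} : expR (x / (1 + x)) <= 1 + x.
  rewrite -[leRHS]invrK -[leLHS]invrK -expRN lef_pV2 ?posrE ?expR_gt0 ?invr_gt0//.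
  by rewrite (le_trans _ h)// [leRHS](_ : _ = (1 + x)^-1)//; field.
apply: le_trans; rewrite ler_expR ler_pdivlMr//; nra.
Qed.

End RealPowers.

(** * Taylor coefficients of Dirichlet series *)

Section DirichletTaylor.
Variable R : realType.
Implicit Types (r s t a d C c : R) (u b : nat -> R).

(* [dphi a n k] is, up to the sign [(-1) ^ k], the [k]-th Taylor coefficient of
   [s |-> n ^ (- s)] at [s = a]; it vanishes at [n = 0] as soon as [a != 0]. *)
Definition dphi a (n k : nat) : R := exp_coeff (ln n%:R) k * n%:R `^ (- a).

Lemma dphi_ge0 a n k : 0 <= dphi a n k.
Proof. by rewrite mulr_ge0 ?powR_ge0// exp_coeff_ge0// ln_nat_ge0. Qed.

Lemma dphi0 a k : a != 0 -> dphi a 0 k = 0.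
Proof. by move=> a0; rewrite /dphi powR0 ?mulr0// oppr_eq0. Qed.

Lemma dphi_ord0 a n : dphi a n 0 = n%:R `^ (- a).
Proof. by rewrite /dphi /exp_coeff/= expr0 fact0 divr1 mul1r. Qed.

Lemma dphiM a m n : (0 < m)%N -> (0 < n)%N ->
  dphi a (m * n) =1 cauchy_prod (dphi a m) (dphi a n).
Proof.
move=> m0 n0 k; rewrite /dphi natrM lnM ?posrE ?ltr0n// exp_coeffD.
rewrite powRM// /cauchy_prod mulr_suml; apply: eq_bigr => j _; ring.
Qed.

Lemma dphiS a n k : ln n%:R * dphi a n k = k.+1%:R * dphi a n k.+1.
Proof. by rewrite /dphi mulrA exp_coeffS mulrA. Qed.

Lemma wnorm_dphi r a n K : 0 <= r -> (0 < n)%N ->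
  wnorm r K (dphi a n) <= n%:R `^ (r - a).
Proof.
move=> r0 n0; rewrite powR_natD// mulrC.
rewrite (@eq_wnorm _ _ _ _ (fun k => n%:R `^ (- a) * exp_coeff (ln n%:R) k)); last first.
  by move=> k; rewrite mulrC.
rewrite wnormZ (ger0_norm (powR_ge0 _ _)) ler_wpM2l ?powR_ge0//.
by rewrite powR_natE// wnorm_exp_coeff// ln_nat_ge0.
Qed.

(** Cauchy's estimate: a single term is at most the whole norm. *)
Lemma dphi_le r a n k : 0 < r -> (0 < n)%N -> dphi a n k <= r ^- k * n%:R `^ (r - a).
Proof.
move=> r0 n0; rewrite mulrC ler_pdivlMr ?exprn_gt0//.
rewrite (le_trans _ (wnorm_dphi a k.+1 (ltW r0) n0))// /wnorm big_ord_recr/=.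
rewrite (ger0_norm (dphi_ge0 _ _ _)) lerDr sumr_ge0// => i _.
by rewrite mulr_ge0// exprn_ge0// ltW.
Qed.

(** The difference splits into a change of the exponential coefficients and a change of [n ^ (- a)];
    each gains a factor [1 / n]. The constants add up to [1 + 2 * a], at most [5]. *)
Lemma wnorm_dphiB r a n K : 0 <= r <= 1 -> 1 <= a <= 2 -> (0 < n)%N ->
  wnorm r K (fun k => dphi a n k - dphi a n.+1 k) <= 5 * n%:R `^ (r - a - 1).
Proof.
move=> /andP[r0 r1] /andP[a1 a2] n0.
set x := ln n%:R : R; set y := ln n.+1%:R : R.
have x0 : 0 <= x by exact: ln_nat_ge0.
have xy : x <= y by rewrite ler_ln ?posrE ?ltr0n// ler_nat.
have a0 : 0 <= a by lra.
pose w1 k := n%:R `^ (- a) * - (exp_coeff y k - exp_coeff x k).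
pose w2 k := (n%:R `^ (- a) - n.+1%:R `^ (- a)) * exp_coeff y k.
rewrite (@eq_wnorm _ _ _ _ (fun k => w1 k + w2 k)); last first.
  by move=> k; rewrite /dphi /w1 /w2 -/x -/y; ring.
rewrite (le_trans (wnormD _ _ _ r0))// !wnormZ wnormN.
rewrite !ger0_norm ?powR_ge0 ?subr_ge0 ?powR_succ_leN//.
have h1 : wnorm r K (fun k => exp_coeff y k - exp_coeff x k) <= n%:R `^ (r - 1).
  rewrite (le_trans (wnorm_exp_coeffB _ _ _))// ?x0//.
  rewrite /x /y -!powR_natE// powR_natD// powR_inv1//.
  have r01 : 0 <= r <= 1 by rewrite r0.
  by have := powR_succ_le n0 r01; rewrite mulrDr mulr1 lerBlDl.
have h2 : wnorm r K (exp_coeff y) <= 2 * n%:R `^ r.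
  rewrite (le_trans (wnorm_exp_coeff _ _ _)) ?(le_trans x0 xy)//.
  rewrite /y -powR_natE// (le_trans (powR_succ_le n0 _)) ?r0// mulrC ler_wpM2r ?powR_ge0//.
  have : n%:R^-1 <= 1 :> R by rewrite invf_le1 ?ltr0n ?ler1n.
  lra.
apply: (@le_trans _ _ (n%:R `^ (- a) * n%:R `^ (r - 1) +
    (a * n%:R `^ (- a - 1)) * (2 * n%:R `^ r))).
  apply: lerD; first by rewrite ler_wpM2l ?powR_ge0.
  apply: ler_pM => //; rewrite ?subr_ge0 ?powR_succ_leN ?wnorm_ge0//.
  exact: powR_pred_sub.
rewrite -powR_natD// [X in _ + X](_ : _ = (2 * a) * (n%:R `^ (- a - 1) * n%:R `^ r)); last by ring.
rewrite -powR_natD//.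
have -> : - a + (r - 1) = r - a - 1 by ring.
have -> : - a - 1 + r = r - a - 1 by ring.
rewrite -[X in X + _]mul1r -mulrDl ler_wpM2r ?powR_ge0//; lra.
Qed.

(** The [1] bounds the boundary term of the partial summation; the rest is the constant of
    [wnorm_dphiB] times the bound of [series_powR_le] at [t = d / 2]. *)
Definition abel_const d : R := 1 + 5 * (1 + (d / 2)^-1).

Lemma abel_const_ge0 d : 0 < d -> 0 <= abel_const d.
Proof.
move=> d0; have : 0 <= (d / 2)^-1 by rewrite invr_ge0 divr_ge0// ltW.
rewrite /abel_const; lra.
Qed.

(** Half of the saving [d] pays for the radius [d / 2]; the other half keeps the increments below
    [n ^ (- 1 - d / 2)]. Since only [a >= 1] enters, the bound is uniform as [a] decreases to
    [1]. *)
Lemma wnorm_abel a d C u K X : 0 < d < 1 -> 1 <= a <= 2 ->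
  (forall n, `|series u n.+1| <= C * n%:R `^ (1 - d)) ->
  wnorm (d / 2) K (fun k => series (fun n => u n * dphi a n k) X) <= C * abel_const d.
Proof.
move=> /andP[d0 d1] /andP[a1 a2] uC.
have C0 : 0 <= C by have := uC 1%N; rewrite powR1 mulr1; exact: le_trans.
have r0 : 0 <= d / 2 by lra.
have e0 : 1 - d != 0 by rewrite gt_eqF//; lra.
rewrite (@eq_wnorm _ _ _ _ (fun k => series u X * dphi a X k +
   \sum_(0 <= n < X) series u n.+1 * (dphi a n k - dphi a n.+1 k))); last first.
  by move=> k; rewrite (abel_summation u (fun n => dphi a n k)).
rewrite (le_trans (wnormD _ _ _ r0))// /abel_const mulrDr lerD//.
  rewrite mulr1 wnormZ; case: X => [|X].
    by rewrite /series/= big_geq// normr0 mul0r.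
  apply: (@le_trans _ _ (C * X.+1%:R `^ (1 - d) * X.+1%:R `^ (d / 2 - a))).
    rewrite ler_pM ?wnorm_ge0 ?wnorm_dphi// (le_trans (uC X))// ler_wpM2l//.
    by rewrite ge0_ler_powR// ?nnegrE//; [lra|rewrite ler_nat].
  by rewrite -mulrA -powR_natD// ler_piMr// powR_nat_le1//; lra.
rewrite (le_trans (wnorm_sum _ _ _ _ r0))//.
apply: (@le_trans _ _ (C * (5 * series (fun n => n%:R `^ (- 1 - d / 2)) X))); last first.
  by rewrite ler_wpM2l// ler_wpM2l// series_powR_le//; lra.
rewrite /series/= !mulr_sumr; apply: ler_sum => -[|n] _.
  have : `|series u 1| <= 0 by rewrite (le_trans (uC 0%N))// powR0// mulr0.
  rewrite normr_le0 => /eqP u1; rewrite wnormZ.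
  by move: u1; rewrite /series/= => ->; rewrite normr0 mul0r !mulr_ge0 ?powR_ge0.
rewrite wnormZ.
apply: (@le_trans _ _ (C * n.+1%:R `^ (1 - d) * (5 * n.+1%:R `^ (d / 2 - a - 1)))).
  rewrite ler_pM ?wnorm_ge0 ?uC// wnorm_dphiB ?a1 ?r0//; lra.
rewrite -mulrA ler_wpM2l// mulrCA ler_wpM2l// -powR_natD// ler_powR_nat//; lra.
Qed.

Lemma dphi_dom a : 1 < a -> forall k, exists c, forall n,
  dphi a n k <= c * n%:R `^ (- 1 - (a - 1) / 2).
Proof.
move=> a1 k; exists (((a - 1) / 2) ^- k) => -[|n].
  by rewrite dphi0 ?mulr_ge0 ?powR_ge0 ?invr_ge0 ?exprn_ge0//; [lra|rewrite gt_eqF//; lra].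
rewrite (le_trans (dphi_le _ k (_ : 0 < (a - 1) / 2) _))//; first lra.
rewrite ler_wpM2l ?invr_ge0 ?exprn_ge0 ?ler_powR_nat//; lra.
Qed.

Lemma is_cvg_dphi a k : 1 < a -> cvgn (series (fun n => dphi a n k)).
Proof.
move=> a1; have [c hc] := dphi_dom a1 k.
apply: (@series_le_cvg _ _ (fun n => c * n%:R `^ (- 1 - (a - 1) / 2))).
- by move=> n; exact: dphi_ge0.
- by move=> n; rewrite (le_trans _ (hc n))// dphi_ge0.
- exact: hc.
- by apply: is_cvg_seriesZ; apply: is_cvg_series_powR; lra.
Qed.

Lemma is_cvg_series_dphi a u c k : 1 < a -> (forall n, `|u n| <= c) ->
  cvgn (series (fun n => u n * dphi a n k)).
Proof.
move=> a1 uc; apply: normed_cvg.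
apply: (@series_le_cvg _ _ (fun n => c * dphi a n k)) => [n|n|n|] /=.
- by [].
- by rewrite mulr_ge0 ?dphi_ge0// (le_trans _ (uc n)).
- by rewrite normrM (ger0_norm (dphi_ge0 _ _ _)) ler_wpM2r ?dphi_ge0.
- by apply: is_cvg_seriesZ; exact: is_cvg_dphi.
Qed.

(** Up to the sign [(-1) ^ k], the [k]-th Taylor coefficient at [a] of the Dirichlet series of
    [u]. *)
Definition dser a u (k : nat) : R := limn (series (fun n => u n * dphi a n k)).

Lemma cvg_sumr (I : Type) (rI : seq I) (h : I -> nat -> R) (l : I -> R) :
  (forall i, h i @ \oo --> l i) ->
  (fun n => \sum_(i <- rI) h i n) @ \oo --> \sum_(i <- rI) l i.
Proof.
move=> hl; elim: rI => [|i rI IH].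
  by under eq_fun do rewrite big_nil; rewrite big_nil; exact: cvg_cst.
by under eq_fun do rewrite big_cons; rewrite big_cons; exact: cvgD.
Qed.

Lemma wnorm_lim r K (s : nat -> nat -> R) (l : nat -> R) B : 0 <= r ->
  (forall X, wnorm r K (s X) <= B) -> (forall k, (fun X => s X k) @ \oo --> l k) ->
  wnorm r K l <= B.
Proof.
move=> r0 sB sl.
have h : (fun X => wnorm r K (s X)) @ \oo --> wnorm r K l.
  rewrite /wnorm; apply: (@cvg_sumr _ _ (fun (k : 'I_K) X => `|s X k| * r ^+ k)) => k.
  by apply: cvgMl; apply: cvg_norm; exact: sl.
by apply: (cvgr_to_le h); near=> X.
Unshelve. all: by end_near. Qed.

Lemma wnorm_dser a d C c u K : 0 < d < 1 -> 1 < a <= 2 -> (forall n, `|u n| <= c) ->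
  (forall n, `|series u n.+1| <= C * n%:R `^ (1 - d)) ->
  wnorm (d / 2) K (dser a u) <= C * abel_const d.
Proof.
move=> d01 /andP[a1 a2] uc uC.
apply: (@wnorm_lim _ _ (fun X k => series (fun n => u n * dphi a n k) X)).
- lra.
- by move=> X; apply: wnorm_abel; rewrite ?(ltW a1).
- by move=> k; exact: (is_cvg_series_dphi a1 uc).
Qed.

Lemma series_tail_lt b (e : R) : (forall n, 0 <= b n) -> cvgn (series b) -> 0 < e ->
  exists Q0, forall Q, (Q0 <= Q)%N -> forall N, (Q <= N)%N -> \sum_(Q <= q < N) b q < e.
Proof.
move=> b0 cb e0; have /cvgrPdist_lt/(_ _ e0)[Q0 _ hQ] := cb.
exists Q0 => Q Q0Q N QN.
have nd : nondecreasing_seq (series b) by exact: nondecreasing_series.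
have := nondecreasing_cvgn_le nd cb N.
have := hQ Q Q0Q; rewrite ger0_norm ?subr_ge0; last exact: nondecreasing_cvgn_le.
have : \sum_(Q <= q < N) b q = series b N - series b Q by rewrite sub_series_geq.
by move: (\sum_(Q <= q < N) _) (series b N) => ? ?; lra.
Qed.

(** Here the range of summation grows together with the parameter [N]. Beyond a fixed [Q] the
    dominating series controls both sums; below [Q] there are finitely many termwise limits. *)
Lemma tannery (t : nat -> nat -> R) (l b : nat -> R) :
  cvgn (series b) -> (forall N q, `|t N q| <= b q) ->
  (forall q, (fun N => t N q) @ \oo --> l q) ->
  (fun N => \sum_(0 <= q < N) t N q) @ \oo --> limn (series l).
Proof.
move=> cb tb tl.
have lb q : `|l q| <= b q.
  by apply: (cvgr_to_le (cvg_norm (tl q))); near=> N.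
have b0 q : 0 <= b q by exact: le_trans (lb q).
have cl : cvgn (series l).
  by apply: normed_cvg; apply: (series_le_cvg _ _ lb) => // n.
suff : (fun N => \sum_(0 <= q < N) t N q) - series l @ \oo --> (0 : R).
  move=> h; rewrite -[X in _ --> X]add0r.
  have -> : (fun N => \sum_(0 <= q < N) t N q) =
     ((fun N => \sum_(0 <= q < N) t N q) - series l) + series l by rewrite subrK.
  exact: cvgD.
apply/cvgrPdist_lt => e e0.
(* One quarter goes to the head and two to the tail, where [t N q - l q] is bounded by [2 * b q]. *)
have e4 : 0 < e / 4 by lra.
have [Q hQ0] := series_tail_lt b0 cb e4; have hQ := hQ0 Q (leqnn Q).
have fin : (fun N => \sum_(0 <= q < Q) `|t N q - l q|) @ \oo --> (0 : R).
  rewrite [X in _ --> X](_ : _ = \sum_(0 <= q < Q) `|l q - l q|); last first.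
    by rewrite big1// => q _; rewrite subrr normr0.
  apply: (@cvg_sumr _ _ (fun q N => `|t N q - l q|)) => q.
  by apply: cvg_norm; apply: cvgB => //; exact: cvg_cst.
have /cvgrPdist_lt/(_ _ e4) fin' := fin.
near=> N.
have QN : (Q <= N)%N by near: N; exact: nbhs_infty_ge.
rewrite sub0r normrN.
have -> : ((fun N => \sum_(0 <= q < N) t N q) - series l) N =
   \sum_(0 <= q < N) (t N q - l q) by rewrite sumrB.
rewrite (le_lt_trans (ler_norm_sum _ _ _))// (big_cat_nat (n := Q))//=.
have h1 : \sum_(0 <= q < Q) `|t N q - l q| < e / 4.
  have : `|0 - \sum_(0 <= q < Q) `|t N q - l q| | < e / 4 by near: N.
  by rewrite sub0r normrN ger0_norm// sumr_ge0.
have h2 : \sum_(Q <= q < N) `|t N q - l q| <= 2 * \sum_(Q <= q < N) b q.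
  rewrite mulr_sumr; apply: ler_sum => q _.
  by rewrite (le_trans (ler_normB _ _))// mulrDl mul1r lerD.
have := hQ N QN; lra.
Unshelve. all: by end_near. Qed.

End DirichletTaylor.

(** * Sums over the multiples of an integer *)

Section Multiples.
Variable R : realType.

Lemma sum_multiples (g : nat -> R) p n : (0 < p)%N ->
  \sum_(0 <= k < n.+1 | (p %| k)%N) g k = \sum_(0 <= m < (n %/ p).+1) g (p * m)%N.
Proof.
move=> p0; elim: n => [|n IH].
  by rewrite div0n big_mkcond !big_nat1 dvdn0 muln0.
rewrite big_mkcond big_nat_recr//= -big_mkcond/= IH divnS//.
case: ifPn => [pn|_]; last by rewrite add0n addr0.
rewrite add1n [in RHS]big_nat_recr//=; congr (_ + g _).
by have := divnK pn; rewrite divnS// pn add1n mulnC => ->.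
Qed.

(** With the cutoff [(p * X).+1] a sum over the multiples [p * m] runs exactly over [m <= X]; limits
    are therefore read along these cutoffs. *)
Lemma cvg_muln_succ (u : nat -> R) (l : R) (p : nat) : (0 < p)%N ->
  u @ \oo --> l -> (fun X => u (p * X).+1) @ \oo --> l.
Proof.
move=> p0 ul; apply: cvg_trans ul => A [N _ hN].
exists N => // X /= NX; apply: hN => /=.
by rewrite (leq_trans NX)// ltnW// ltnS leq_pmull.
Qed.

End Multiples.

(** * Multiples of a prime and the logarithmic derivative *)

Section SquarefreeMultiplicative.
Variables (R : realType) (f : nat -> R).
Hypothesis f0 : f 0%N = 0.
Hypothesis f_le1 : forall n, `|f n| <= 1.
Hypothesis fM : forall p m, prime p -> (0 < m)%N ->
  f (p * m)%N = if (p %| m)%N then 0 else f p * f m.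
Implicit Types (r s t a d C c : R).

(** For [p] prime, its Dirichlet series [H] satisfies [H = f(p) p^(-s) (F - H)]. Working with this
    relation replaces inverting the Euler factor [1 + f(p) p^(-s)]. *)
Definition multiple_part p n : R := if (p %| n)%N then f n else 0.

Lemma multiple_part_le1 p n : `|multiple_part p n| <= 1.
Proof. by rewrite /multiple_part; case: ifP => _; rewrite ?normr0. Qed.

Lemma fM_multiple_part p m : prime p -> f (p * m)%N = f p * (f m - multiple_part p m).
Proof.
move=> pp; rewrite /multiple_part; case: (posnP m) => [->|m0].
  by rewrite muln0 dvdn0 f0 subrr mulr0.
by rewrite fM//; case: ifP => _; rewrite ?subrr ?mulr0 ?subr0.
Qed.

Lemma series_multiple_part p n : prime p ->
  series (multiple_part p) n.+1 =
  f p * (series f (n %/ p).+1 - series (multiple_part p) (n %/ p).+1).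
Proof.
move=> pp; rewrite /series/= -sumrB mulr_sumr.
have -> : \sum_(0 <= k < n.+1) multiple_part p k = \sum_(0 <= k < n.+1 | (p %| k)%N) f k.
  by rewrite [RHS]big_mkcond.
by rewrite sum_multiples ?prime_gt0//; apply: eq_bigr => m _; exact: fM_multiple_part.
Qed.

(** Strong induction along [n %/ p]. The ratio [p ^ (- (1 - d)) <= 3 / 4] makes the constant [4]
    reproduce itself, as [1 + 4 * (3 / 4) = 4]. *)
Lemma series_multiple_part_le C d p n : 0 < d <= 4^-1 -> prime p ->
  (forall n, `|series f n.+1| <= C * n%:R `^ (1 - d)) ->
  `|series (multiple_part p) n.+1| <= (4 * C * p%:R `^ (- (1 - d))) * n%:R `^ (1 - d).
Proof.
move=> /andP[d0 d1] pp fC.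
have C0 : 0 <= C by have := fC 1%N; rewrite powR1 mulr1; exact: le_trans.
have p0 := prime_gt0 pp; have p1 := prime_gt1 pp.
have ple : p%:R `^ (- (1 - d)) <= 3 / 4 :> R.
  apply: (le_trans _ (@powR2_le R (1 - d) _)); last lra.
  rewrite !powRN lef_pV2 ?posrE ?powR_gt0 ?ltr0n//.
  by rewrite ge0_ler_powR ?nnegrE ?ler_nat//; lra.
elim/ltn_ind: n => n IH.
case: (posnP n) => [->|n0].
  rewrite /series/= big_nat1 /multiple_part dvdn0 f0 normr0 !mulr_ge0 ?powR_ge0//.
rewrite series_multiple_part// normrM (le_trans (ler_piMl _ (f_le1 p)))//.
rewrite (le_trans (ler_normB _ _))//.
have IHn := IH _ (ltn_Pdiv p1 n0).
apply: (@le_trans _ _ (4 * C * (n %/ p)%:R `^ (1 - d))).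
  have h1 := fC (n %/ p)%N; have z := powR_ge0 (n %/ p)%:R (1 - d).
  have Cz := mulr_ge0 C0 z.
  have := ler_wpM2r Cz ple.
  move: IHn h1 Cz; set x := _ `^ (1 - d); set y := _ `^ (- _).
  move=> IHn h1 Cz h2; have -> : 4 * C * x = C * x + 4 * (3 / 4 * (C * x)) by field.
  rewrite lerD// (le_trans IHn)//.
  by rewrite (_ : 4 * C * y * x = 4 * (y * (C * x))) ?ler_wpM2l//; ring.
rewrite -[leRHS]mulrA ler_wpM2l ?mulr_ge0// powRN [leRHS]mulrC ler_pdivlMr ?powR_gt0 ?ltr0n//.
rewrite -powRM// -natrM ge0_ler_powR ?nnegrE//; first lra.
by rewrite ler_nat leq_trunc_div.
Qed.

(** By [fM], [f] vanishes off the squarefree integers, so removing [pdiv n] repeatedly meets each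
    prime factor once. *)
Lemma ln_sum_primes n X : (0 < n < X)%N -> f n != 0 ->
  ln n%:R = \sum_(0 <= p < X | prime p && (p %| n)%N) ln p%:R :> R.
Proof.
elim/ltn_ind: n => n IH /andP[n0 nX] fn.
case: (ltngtP n 1%N) => [||n1]; first by case: n n0 {IH nX fn} => [|[]].
  move=> n1; set p := pdiv n.
  have pp : prime p by exact: pdiv_prime.
  have nE : n = (p * (n %/ p))%N by rewrite mulnC divnK// pdiv_dvd.
  have m0 : (0 < n %/ p)%N by rewrite divn_gt0 ?prime_gt0// dvdn_leq// pdiv_dvd.
  have mn : (n %/ p < n)%N by rewrite ltn_Pdiv// prime_gt1.
  have pX : (p < X)%N by rewrite (leq_ltn_trans _ nX)// dvdn_leq// pdiv_dvd.
  set m := (n %/ p)%N in nE m0 mn *.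
  clearbody m; clearbody p.
  have /andP[pm fm] : ~~ (p %| m)%N && (f m != 0).
    move: fn; rewrite nE fM//; case: (p %| m)%N; first by rewrite eqxx.
    by rewrite mulf_eq0 negb_or => /andP[].
  have mX : (0 < m < X)%N by rewrite m0 (ltn_trans mn).
  have p0 := prime_gt0 pp.
  rewrite nE natrM lnM ?posrE ?ltr0n// (IH m mn mX fm).
  rewrite big_mkcond/= [RHS]big_mkcond/=.
  have -> : ln p%:R = \sum_(0 <= q < X) if q == p then ln p%:R else 0 :> R.
    by rewrite -big_mkcond/= big_nat1_eq pX.
  rewrite -big_split/=; apply: eq_bigr => q _.
  case: (boolP (prime q)) => qp /=; last first.
    by rewrite ifF ?addr0//; apply: contraNF qp => /eqP ->.
  rewrite Euclid_dvdM// (dvdn_prime2 qp pp).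
  by case: eqP => [->|_] /=; rewrite ?(negbTE pm) ?addr0 ?add0r.
rewrite n1 ln1 big1// => p /andP[pp].
by rewrite dvdn1 => /eqP p1; rewrite p1 in pp.
Qed.

Lemma series_multiple_part_dphi a p k X : prime p ->
  series (fun n => multiple_part p n * dphi a n k) (p * X).+1 =
  f p * \sum_(j < k.+1) dphi a p j *
    series (fun m => (f m - multiple_part p m) * dphi a m (k - j)%N) X.+1.
Proof.
move=> pp; have p0 := prime_gt0 pp.
have -> : series (fun n => multiple_part p n * dphi a n k) (p * X).+1 =
    \sum_(0 <= n < (p * X).+1 | (p %| n)%N) f n * dphi a n k.
  rewrite /series/= [RHS]big_mkcond; apply: eq_bigr => n _.
  by rewrite /multiple_part; case: ifP => _; rewrite ?mul0r.
rewrite sum_multiples// mulKn// /series/=.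
rewrite mulr_sumr; under [RHS]eq_bigr do rewrite !mulr_sumr.
rewrite exchange_big/=; apply: eq_bigr => m _.
case: (posnP m) => [->|m0].
  rewrite muln0 f0 mul0r big1// => j _.
  by rewrite /multiple_part dvdn0 f0 subrr mul0r !mulr0.
rewrite fM_multiple_part// dphiM// /cauchy_prod mulr_sumr.
by apply: eq_bigr => j _; ring.
Qed.

Lemma cvg_multiple_part a p k : 1 < a ->
  series (fun n => multiple_part p n * dphi a n k) @ \oo --> dser a (multiple_part p) k.
Proof. by move=> a1; exact: (is_cvg_series_dphi a1 (multiple_part_le1 p)). Qed.

Lemma cvg_series_f a k : 1 < a ->
  series (fun n => f n * dphi a n k) @ \oo --> dser a f k.
Proof. by move=> a1; exact: (is_cvg_series_dphi a1 f_le1). Qed.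

Lemma dser_multiple_part a p k : 1 < a -> prime p ->
  dser a (multiple_part p) k =
  f p * cauchy_prod (dphi a p) (fun i => dser a f i - dser a (multiple_part p) i) k.
Proof.
move=> a1 pp.
have h1 : (fun X => series (fun n => multiple_part p n * dphi a n k) (p * X).+1) @ \oo
    --> dser a (multiple_part p) k.
  by apply: (cvg_muln_succ (prime_gt0 pp)); exact: cvg_multiple_part.
have h2 : (fun X => series (fun n => multiple_part p n * dphi a n k) (p * X).+1) @ \oo
    --> f p * cauchy_prod (dphi a p) (fun i => dser a f i - dser a (multiple_part p) i) k.
  under eq_fun do rewrite series_multiple_part_dphi//.
  apply: cvgMr; apply: (@cvg_sumr _ _ _ (fun (j : 'I_k.+1) X => dphi a p j *
    series (fun m => (f m - multiple_part p m) * dphi a m (k - j)%N) X.+1)) => j.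
  apply: cvgMr.
  rewrite (@cvg_shiftS R (series (fun m => (f m - multiple_part p m) * dphi a m (k - j)%N))).
  rewrite (_ : series _ = series (fun m => f m * dphi a m (k - j)%N) -
     series (fun m => multiple_part p m * dphi a m (k - j)%N)); last first.
    apply/funext => X; rewrite -[RHS]/(series _ X - series _ X) /series/= -sumrB.
    by apply: eq_bigr => m _; rewrite mulrBl.
  by apply: cvgB; [exact: cvg_series_f|exact: cvg_multiple_part].
by rewrite -(cvg_lim _ h1)// (cvg_lim _ h2).
Qed.

(* The Dirichlet series of [f] satisfies [- F' = L F - E], where [L] runs over
   the primes and [E] collects the contribution of the squares of primes. *)
Lemma cvg_log_derivative a k : 1 < a ->
  series (fun p => if prime p then ln p%:R * dser a (multiple_part p) k else 0) @ \oo
    --> k.+1%:R * dser a f k.+1.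
Proof.
move=> a1.
pose t X p := if prime p then
  ln p%:R * series (fun n => multiple_part p n * dphi a n k) X else 0.
(* Both [p] and [n] are cut at [X]. Prime factors of [n < X] are below [X], so summing over [p]
   first recovers [ln n] exactly, and [dphiS] turns it into a shift of the index. *)
have tE X : \sum_(0 <= p < X) t X p = k.+1%:R * series (fun n => f n * dphi a n k.+1) X.
  rewrite /series/= mulr_sumr /t.
  under eq_bigr do rewrite /series/= mulr_sumr.
  rewrite -big_mkcond/= exchange_big/= big_nat [RHS]big_nat.
  apply: eq_bigr => n /andP[_ nX].
  case: (posnP n) => [->|n0].
    by rewrite f0 mul0r mulr0 big1// => p _; rewrite /multiple_part dvdn0 f0 mul0r mulr0.
  rewrite mulrCA -dphiS mulrCA.
  have [fn|fn] := eqVneq (f n) 0.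
    rewrite fn mul0r mulr0 big1// => p _; rewrite /multiple_part fn.
    by rewrite if_same mul0r mulr0.
  rewrite (@ln_sum_primes n X) ?n0// mulr_suml big_mkcondr/=.
  apply: eq_bigr => p _; rewrite /multiple_part.
  by case: ifP => _; rewrite ?mul0r ?mulr0.
have ct : (fun X => \sum_(0 <= p < X) t X p) @ \oo --> k.+1%:R * dser a f k.+1.
  by under eq_fun do rewrite tE; apply: cvgMr; exact: cvg_series_f.
pose A (i : nat) : R := limn (series (fun n => dphi a n i)).
have AE i X : series (fun n => dphi a n i) X <= A i.
  apply: nondecreasing_cvgn_le; last exact: is_cvg_dphi.
  by apply: nondecreasing_series => n _ _; exact: dphi_ge0.
have A0 i : 0 <= A i.
  by rewrite (le_trans _ (AE i 0%N))// /series/= big_geq.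
(* The majorant of [t X p]: bound [f] by one, write [n = p * m], let [m] run over all integers,
   which gives [A], and absorb [ln p] through [dphiS]. *)
pose b p := \sum_(j < k.+1) j.+1%:R * dphi a p j.+1 * A (k - j)%N.
have cb : cvgn (series b).
  pose v (j : 'I_k.+1) p := j.+1%:R * dphi a p j.+1 * A (k - j)%N.
  have -> : series b = fun X => \sum_(j < k.+1) series (v j) X.
    by apply/funext => X; rewrite /series/= exchange_big.
  apply/cvg_ex; exists (\sum_(j < k.+1) limn (series (v j))).
  apply: (@cvg_sumr _ _ _ (fun j X => series (v j) X)) => j.
  have -> : v j =
     (j.+1%:R * A (k - j)%N) *: (fun p => dphi a p j.+1).
    by apply/funext => p; rewrite /v mulrAC.
  by apply: is_cvg_seriesZ; exact: is_cvg_dphi.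
have tb X p : `|t X p| <= b p.
  rewrite /t; case: ifPn => pp; last first.
    rewrite normr0 /b; apply: sumr_ge0 => j _; apply: mulr_ge0; last exact: A0.
    by apply: mulr_ge0; [exact: ler0n|exact: dphi_ge0].
  have p0 := prime_gt0 pp.
  rewrite normrM (ger0_norm (ln_nat_ge0 _ _)).
  apply: (@le_trans _ _ (ln p%:R * \sum_(j < k.+1) dphi a p j * A (k - j)%N)); last first.
    rewrite mulr_sumr; apply: ler_sum => j _; rewrite mulrA dphiS//.
  rewrite ler_wpM2l ?ln_nat_ge0//.
  apply: (@le_trans _ _ (\sum_(0 <= n < (p * X).+1 | (p %| n)%N) dphi a n k)).
    rewrite (le_trans (ler_norm_sum _ _ _))//.
    rewrite [leRHS]big_mkcond/= [leRHS](big_cat_nat (n := X))//=; last first.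
      by rewrite ltnW// ltnS leq_pmull.
    rewrite -[leLHS]addr0; apply: lerD.
      apply: ler_sum => n _; rewrite normrM (ger0_norm (dphi_ge0 _ _ _)) /multiple_part.
      case: ifP => _; last by rewrite normr0 mul0r.
      by rewrite ler_piMl ?dphi_ge0.
    by apply: sumr_ge0 => n _; case: ifP => _ //; exact: dphi_ge0.
  rewrite sum_multiples// mulKn//.
  apply: (@le_trans _ _ (\sum_(0 <= m < X.+1) cauchy_prod (dphi a p) (dphi a m) k)).
    apply: ler_sum => -[|m] _; last by rewrite dphiM.
    rewrite muln0 dphi0; last by rewrite gt_eqF// (lt_trans ltr01).
    by apply: sumr_ge0 => j _; rewrite mulr_ge0 ?dphi_ge0.
  rewrite /cauchy_prod exchange_big/=; apply: ler_sum => j _.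
  by rewrite -mulr_sumr ler_wpM2l ?dphi_ge0//; exact: AE.
have tl p : (fun X => t X p) @ \oo -->
    (if prime p then ln p%:R * dser a (multiple_part p) k else 0).
  rewrite /t; case: ifP => _; last exact: cvg_cst.
  by apply: cvgMr; exact: cvg_multiple_part.
have T := tannery cb tb tl.
rewrite -(cvg_lim _ ct)// (cvg_lim _ T)//.
have cl : cvgn (series (fun p => if prime p then ln p%:R * dser a (multiple_part p) k else 0)).
  apply: normed_cvg; apply: (series_le_cvg _ _ _ cb) => p /=.
  - by [].
  - by rewrite (le_trans _ (tb 0%N p)).
  - by apply: (cvgr_to_le (cvg_norm (tl p))); near=> X.
exact: cl.
Unshelve. all: by end_near. Qed.

End SquarefreeMultiplicative.

(** * Finite Euler product and a lower bound near 1 *)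

Section Sieve.
Variables (R : realType) (f : nat -> R).
Hypothesis f0 : f 0%N = 0.
Hypothesis f1 : f 1%N = 1.
Hypothesis f_le1 : forall n, `|f n| <= 1.
Hypothesis fM : forall p m, prime p -> (0 < m)%N ->
  f (p * m)%N = if (p %| m)%N then 0 else f p * f m.
Implicit Types (r s t a d C c x B : R).

Definition rough (N n : nat) : bool :=
  all (fun q => ~~ (prime q && (q %| n)%N)) (iota 0 N).

Definition rough_part N n : R := if rough N n then f n else 0.

Lemma roughS N n : rough N.+1 n = rough N n && ~~ (prime N && (N %| n)%N).
Proof. by rewrite /rough -addn1 iotaD all_cat /= andbT. Qed.

Lemma rough_mul N m : prime N -> rough N (N * m) = rough N m.
Proof.
move=> Np; apply: eq_in_all => q; rewrite mem_iota add0n => /= qN.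
case: (boolP (prime q)) => //= qp.
by rewrite Euclid_dvdM// (dvdn_prime2 qp Np) ltn_eqF.
Qed.

Lemma rough_part_le1 N n : `|rough_part N n| <= 1.
Proof. by rewrite /rough_part; case: ifP => _; rewrite ?normr0. Qed.

Lemma rough_part_mul N m : prime N -> rough_part N (N * m) = f N * rough_part N.+1 m.
Proof.
move=> Np; rewrite /rough_part rough_mul// roughS Np/=.
case: (posnP m) => [->|m0]; first by rewrite muln0 f0 !if_same mulr0.
rewrite fM//; case: (rough N m) => /=; last by rewrite mulr0.
by case: ifP => _ /=; rewrite ?mulr0.
Qed.

Lemma rough_partS N n : prime N ->
  rough_part N n = rough_part N.+1 n + if (N %| n)%N then rough_part N n else 0.
Proof.
move=> Np; rewrite /rough_part roughS Np/=.
by case: (rough N n); case: (N %| n)%N; rewrite /= ?addr0 ?add0r.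
Qed.

Lemma dphi_ord0M a m n : dphi a (m * n) 0 = dphi a m 0 * dphi a n 0.
Proof. by rewrite !dphi_ord0 natrM powRM. Qed.

Lemma series_rough_part a N X : prime N ->
  series (fun n => rough_part N n * dphi a n 0) (N * X).+1 =
  series (fun n => rough_part N.+1 n * dphi a n 0) (N * X).+1 +
  f N * dphi a N 0 * series (fun n => rough_part N.+1 n * dphi a n 0) X.+1.
Proof.
move=> Np; have N0 := prime_gt0 Np.
rewrite /series/=.
under eq_bigr do rewrite (rough_partS _ Np) mulrDl.
rewrite big_split/=; congr (_ + _).
transitivity (\sum_(0 <= n < (N * X).+1 | (N %| n)%N) rough_part N n * dphi a n 0).
  by rewrite [RHS]big_mkcond; apply: eq_bigr => n _; case: ifP => _; rewrite ?mul0r.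
rewrite sum_multiples// mulKn// mulr_sumr; apply: eq_bigr => m _.
by rewrite rough_part_mul// dphi_ord0M; ring.
Qed.

Lemma cvg_rough_part a N : 1 < a ->
  series (fun n => rough_part N n * dphi a n 0) @ \oo --> dser a (rough_part N) 0.
Proof. by move=> a1; exact: (is_cvg_series_dphi a1 (rough_part_le1 N)). Qed.

(** Sieving by a prime [N]: the integers removed are the [N * m], and [f (N * m)] survives only when
    [N] does not divide [m]. *)
Lemma dser_rough_part a N : 1 < a ->
  dser a (rough_part N) 0 =
  (if prime N then 1 + f N * dphi a N 0 else 1) * dser a (rough_part N.+1) 0.
Proof.
move=> a1; case: ifPn => Np; last first.
  rewrite mul1r; congr (dser a _ 0); apply/funext => n.
  by rewrite /rough_part roughS (negbTE Np) andbT.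
have N0 := prime_gt0 Np.
have h1 := cvg_muln_succ N0 (@cvg_rough_part a N a1).
have h2 : (fun X => series (fun n => rough_part N n * dphi a n 0) (N * X).+1) @ \oo -->
   (dser a (rough_part N.+1) 0 + f N * dphi a N 0 * dser a (rough_part N.+1) 0).
  under eq_fun do rewrite series_rough_part//.
  apply: cvgD; first exact: (cvg_muln_succ N0 (@cvg_rough_part a N.+1 a1)).
  apply: cvgMr.
  rewrite (@cvg_shiftS R (series (fun n => rough_part N.+1 n * dphi a n 0))).
  exact: cvg_rough_part.
by rewrite -(cvg_lim _ h1)// (cvg_lim _ h2)//; ring.
Qed.

(** The product stops at [N] with an exact remainder, the series over the integers free of prime
    factors below [N]. *)
Lemma dser_euler a N : 1 < a ->
  dser a f 0 = \prod_(0 <= p < N | prime p) (1 + f p * dphi a p 0) * dser a (rough_part N) 0.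
Proof.
move=> a1; elim: N => [|N ->].
  by rewrite big_geq// mul1r.
rewrite dser_rough_part// mulrA [in RHS]big_mkcond/= [in RHS]big_nat_recr//=.
by rewrite -big_mkcond.
Qed.

Lemma rough_part_small N n : (n < N)%N -> rough_part N n = (n == 1%N)%:R.
Proof.
move=> nN; rewrite /rough_part; case: n nN => [|[|n]] nN.
- by rewrite f0 if_same.
- rewrite f1 ifT//; apply/allP => q _; rewrite dvdn1 negb_and.
  by case: eqP => [->|_]; rewrite ?orbT.
- rewrite ifF//; apply/negP => /allP/(_ (pdiv n.+2)).
  rewrite mem_iota add0n (leq_ltn_trans _ nN) ?pdiv_leq//= => /(_ isT).
  by rewrite pdiv_prime// pdiv_dvd.
Qed.

(** Below [N] only [n = 1] contributes, with value [1]; the rest is dominated by a tail of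
    [sum n ^ (- a)], made smaller than [1 / 2]. *)
Lemma dser_rough_part_ge a : 1 < a -> exists N, 2^-1 <= dser a (rough_part N) 0.
Proof.
move=> a1.
have h : (0 : R) < 2^-1 by lra.
have [Q0 hQ] := series_tail_lt (fun n => dphi_ge0 a n 0) (@is_cvg_dphi _ a 0 a1) h.
(* Adding [2] puts [n = 1] in the head of the sum. *)
pose N := (Q0 + 2)%N; exists N.
apply: (cvgr_to_ge (@cvg_rough_part a N a1)); near=> X.
have NX : (N <= X)%N by near: X; exact: nbhs_infty_ge.
have Q0N : (Q0 <= N)%N by rewrite leq_addr.
rewrite /series/= (big_cat_nat (n := N))//=.
have -> : \sum_(0 <= n < N) rough_part N n * dphi a n 0 = 1.
  rewrite (eq_big_nat _ _ (F2 := fun n => if n == 1%N then 1 else 0)); last first.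
    move=> n /andP[_ nN]; rewrite rough_part_small//.
    by case: eqP => [->|_]; rewrite ?mul0r// dphi_ord0 powR1 mulr1.
  by rewrite -big_mkcond big_nat1_eq /= /N addn2.
have := hQ N Q0N X NX.
have : `|\sum_(N <= n < X) rough_part N n * dphi a n 0| <= \sum_(N <= n < X) dphi a n 0.
  rewrite (le_trans (ler_norm_sum _ _ _))//; apply: ler_sum => n _.
  by rewrite normrM (ger0_norm (dphi_ge0 _ _ _)) ler_piMl ?dphi_ge0 ?rough_part_le1.
by rewrite ler_norml => /andP[+ _]; lra.
Unshelve. all: by end_near. Qed.

(** Partial summation against [n ^ (1 - a)], nonincreasing from [n = 1] on. The jump from [b 0 = 0]
    to [b 1 = 1] raises the total variation bound to [2]. *)
Lemma sum_powR_bound B a X : 1 < a ->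
  (forall X, `|series (fun p => if prime p then f p / p%:R else 0) X| <= B) ->
  `|series (fun p => if prime p then f p * dphi a p 0 else 0) X| <= 2 * B.
Proof.
move=> a1 hB.
set u := fun p => _ in hB.
pose b (n : nat) : R := n%:R `^ (1 - a).
have B0 : 0 <= B by exact: le_trans (hB 0%N).
have -> : (fun p => if prime p then f p * dphi a p 0 else 0) = (fun p => u p * b p).
  apply/funext => p; rewrite /u /b; case: ifPn => pp; last by rewrite mul0r.
  have p0 := prime_gt0 pp.
  by rewrite dphi_ord0 -mulrA; congr (_ * _); rewrite powR_natD// powRr1// mulKf// pnatr_eq0 -lt0n.
rewrite abel_summation (le_trans (ler_normD _ _))//.
have bd n : (0 < n)%N -> b n.+1 <= b n.
  by move=> n0; rewrite /b -opprB powR_succ_leN//; lra.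
have T n : b n.+1 + \sum_(0 <= k < n.+1) `|b k - b k.+1| <= 2.
  elim: n => [|n IH].
    rewrite big_nat1 /b powR1 powR0; last by rewrite lt_eqF//; lra.
    by rewrite sub0r normrN normr1.
  rewrite big_nat_recr//= [X in _ + (_ + X)]ger0_norm ?subr_ge0 ?bd//.
  by move: IH; move: (\sum_(_ <= _ < _) _) => ?; lra.
case: X => [|X].
  by rewrite /series/= !big_geq// mul0r !normr0 addr0 mulr_ge0.
rewrite [leRHS]mulrC; apply: le_trans (ler_wpM2l B0 (T X)).
rewrite mulrDr; apply: lerD.
  by rewrite normrM (ger0_norm (powR_ge0 _ _)) ler_wpM2r ?powR_ge0.
rewrite /series/= (le_trans (ler_norm_sum _ _ _))// mulr_sumr; apply: ler_sum => n _.
by rewrite normrM ler_wpM2r//; exact: hB n.+1.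
Qed.

(** In the exponent, [2 * B] comes from [sum_powR_bound] and [4] from twice [sum p ^ (- 2) <= 2];
    the final [1 / 2] is the rough remainder, whose [N] depends on [a] while the bound does not. *)
Lemma dser_lower_bound B :
  (forall X, `|series (fun p => if prime p then f p / p%:R else 0) X| <= B) ->
  forall a, 1 < a <= 2 -> expR (- (2 * B) - 4) / 2 <= dser a f 0.
Proof.
move=> hB a /andP[a1 a2].
have [N hN] := dser_rough_part_ge a1.
have xle p : prime p -> `|f p * dphi a p 0| <= 2^-1.
  move=> pp; have p0 := prime_gt0 pp.
  rewrite normrM (le_trans (ler_piMl _ (f_le1 p)))//.
  rewrite (ger0_norm (dphi_ge0 _ _ _)) dphi_ord0 powRN.
  rewrite lef_pV2 ?posrE ?powR_gt0 ?ltr0n//.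
  apply: (@le_trans _ _ (p%:R)); first by rewrite ler_nat prime_gt1.
  by apply: le1r_powR; rewrite ?ler1n// ltW.
rewrite (dser_euler N a1); apply: ler_pM => //.
apply: (@le_trans _ _ (\prod_(0 <= p < N | prime p)
    expR (f p * dphi a p 0 - 2 * (f p * dphi a p 0 * (f p * dphi a p 0))))); last first.
  by apply: ler_prod => p pp; rewrite expR_ge0 expR_le1Dx ?xle.
rewrite -expR_sum ler_expR sumrB.
have h1 := sum_powR_bound N a1 hB.
move: h1; rewrite /series/= -big_mkcond/= ler_norml => /andP[h1 _].
apply: lerD; first exact: h1.
rewrite lerN2 -mulr_sumr (_ : 4 = 2 * 2); last by rewrite -natrM.
rewrite ler_wpM2l//.
have := @series_powR_le R 1 N ltr01; rewrite invr1 => h2.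
apply: le_trans h2; rewrite /series/= big_mkcond/=; apply: ler_sum => p _.
case: ifPn => pp; last exact: powR_ge0.
have p0 := prime_gt0 pp.
rewrite -expr2 -real_normK ?num_real// expr2.
rewrite normrM (ger0_norm (dphi_ge0 _ _ _)) dphi_ord0.
apply: (@le_trans _ _ (p%:R `^ (- 1) * p%:R `^ (- 1))); last by rewrite -powR_natD.
have h : `|f p| * p%:R `^ (- a) <= p%:R `^ (- 1).
  by rewrite (le_trans (ler_piMl _ (f_le1 p))) ?powR_ge0 ?ler_powR_nat// lerN2 ltW.
by apply: ler_pM => //; rewrite mulr_ge0 ?powR_ge0.
Qed.

End Sieve.

(** * Analyticity at 1 and Landau's argument on one path *)

Section Landau.
Variables (R : realType) (f e : nat -> R).
Hypothesis f0 : f 0%N = 0.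
Hypothesis f1 : f 1%N = 1.
Hypothesis f_le1 : forall n, `|f n| <= 1.
Hypothesis fM : forall p m, prime p -> (0 < m)%N ->
  f (p * m)%N = if (p %| m)%N then 0 else f p * f m.
Hypothesis e_le0 : forall p, prime p -> e p <= 0.
Variables C C' d B : R.
Hypothesis d_bnd : 0 < d <= 4^-1.
Hypothesis fC : forall n, `|series f n.+1| <= C * n%:R `^ (1 - d).
Hypothesis eC : forall n,
  `|series (fun p => if prime p then f p - e p else 0) n.+1| <= C' * n%:R `^ (1 - d).
Hypothesis fB : forall X, `|series (fun p => if prime p then f p / p%:R else 0) X| <= B.

Let A := abel_const d.
Let c := expR (- (2 * B) - 4) / 2.

Let A0 : 0 <= A. Proof. by apply: abel_const_ge0; case/andP: d_bnd. Qed.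
Let C0 : 0 <= C. Proof. by have := fC 1%N; rewrite powR1 mulr1; exact: le_trans. Qed.
Let C'0 : 0 <= C'. Proof. by have := eC 1%N; rewrite powR1 mulr1; exact: le_trans. Qed.
Let CA0 : 0 <= C * A. Proof. exact: mulr_ge0. Qed.
Let c0 : 0 < c. Proof. by rewrite divr_gt0 ?expR_gt0. Qed.
Let d01 : 0 < d < 1.
Proof. by case/andP: d_bnd => ? ?; apply/andP; split => //; lra. Qed.

Section FixedExponent.
Variables r a : R.
Hypothesis r0 : 0 < r.
Hypothesis rd : r <= d / 4.
Hypothesis rc : r / (d / 2) * (C * A) <= c / 2.
Hypothesis a12 : 1 < a <= 2.

Let a1 : 1 < a. Proof. by case/andP: a12. Qed.
Let F := dser a f.
Let H p := dser a (multiple_part f p).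
(** Cutting at [p < X] keeps the identities between these sums exact. [L] approximates the
    logarithmic derivative up to sign, [E] is its correction from squares of primes, [Z] tends to
    [- F'], and [D] is the target with nonnegative terms. *)
Let L X j := \sum_(0 <= p < X | prime p) ln p%:R * f p * dphi a p j.
Let E X k := \sum_(0 <= p < X | prime p)
  ln p%:R * f p * cauchy_prod (dphi a p) (H p) k.
Let Z X k := \sum_(0 <= p < X | prime p) ln p%:R * H p k.
Let D X k := \sum_(0 <= p < X | prime p) ln p%:R * (- e p) * dphi a p k.

Let wnormF K : wnorm (d / 2) K F <= C * A.
Proof. exact: (wnorm_dser _ d01 a12 f_le1 fC). Qed.

Let bnds : [/\ 0 < r, r <= d / 4, 0 < d, d <= 4^-1 & 1 < a /\ a <= 2].
Proof. by case/andP: d_bnd; case/andP: a12. Qed.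

Let rd2 : 0 <= r <= d / 2.
Proof. by have [? ? ? ? [? ?]] := bnds; apply/andP; split; lra. Qed.

Let wnormH p K : prime p -> wnorm r K (H p) <= 4 * C * p%:R `^ (- (1 - d)) * A.
Proof.
move=> pp; apply: le_trans (wnorm_le _ _ rd2) _.
apply: (wnorm_dser _ d01 a12 (multiple_part_le1 f_le1 p)) => n.
exact: series_multiple_part_le.
Qed.

(** This is the relation [H = f(p) p^(-s) (F - H)] weighted by [ln p] and summed over [p]. *)
Let LFE X k : cauchy_prod (L X) F k = Z X k + E X k.
Proof.
rewrite /Z /E -big_split/= {1}/cauchy_prod /L.
under [LHS]eq_bigr do rewrite mulr_suml.
rewrite exchange_big/=; apply: eq_bigr => p pp.
rewrite {1}/H (dser_multiple_part f0 f_le1 fM)// -/(H p) -/F.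
rewrite mulrA -mulrDr /cauchy_prod -big_split/= mulr_sumr.
by apply: eq_bigr => j _; ring.
Qed.

(** One factor [4] comes from [ln_le_powR], one from [series_multiple_part_le], and [5] bounds the
    sum of [n ^ (- 5 / 4)]; the two powers of [p] together leave room for the logarithm. *)
Let wnormE X K : wnorm r K (E X) <= 80 * (C * A).
Proof.
have r0' := ltW r0.
have [? ? d0 d4 [? a2]] := bnds.
apply: le_trans (wnorm_sum _ _ _ _ r0') _.
apply: (@le_trans _ _ (16 * (C * A) * series (fun n => n%:R `^ (- 1 - 4^-1)) X)).
  rewrite /series/= mulr_sumr big_mkcond/=; apply: ler_sum => p _.
  case: ifPn => pp; last by rewrite !mulr_ge0 ?powR_ge0.
  have p0 := prime_gt0 pp.
  rewrite wnormZ normrM (ger0_norm (ln_nat_ge0 _ _)).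
  apply: (@le_trans _ _ ((4 * p%:R `^ 4^-1) *
      (p%:R `^ (r - a) * (4 * C * p%:R `^ (- (1 - d)) * A)))).
    apply: ler_pM; rewrite ?mulr_ge0 ?ln_nat_ge0 ?wnorm_ge0//.
      by rewrite (le_trans (ler_piMr _ (f_le1 p))) ?ln_nat_ge0 ?ln_le_powR.
    apply: le_trans (wnorm_cauchy_prod _ _ _ r0') _.
    by apply: ler_pM; rewrite ?wnorm_ge0 ?wnorm_dphi ?wnormH.
  rewrite [leLHS](_ : _ = 16 * (C * A) *
    (p%:R `^ 4^-1 * p%:R `^ (r - a) * p%:R `^ (- (1 - d)))); last by ring.
  rewrite ler_wpM2l ?mulr_ge0// -!powR_natD// ler_powR_nat//; lra.
have q0 : (0 : R) < 4^-1 by lra.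
have := series_powR_le X q0; rewrite invrK => h.
rewrite [leRHS](_ : _ = 16 * (C * A) * 5); last by ring.
rewrite ler_wpM2l ?mulr_ge0//; lra.
Qed.

Let cvgZ k : (fun X => Z X k) @ \oo --> k.+1%:R * F k.+1.
Proof.
have -> : (fun X => Z X k) =
    series (fun p => if prime p then ln p%:R * H p k else 0).
  by apply/funext => X; rewrite /Z big_mkcond.
exact: (cvg_log_derivative f0 f_le1 fM).
Qed.

Let wnormF' K : wnorm r K (fun k => k.+1%:R * F k.+1) <= C * A / r.
Proof.
apply: le_trans (wnorm_diff _ _ r0) _.
rewrite ler_wpM2r ?invr_ge0 ?(ltW r0)//; apply: le_trans (wnormF K.+1).
by apply: wnorm_le; have [? ? ? ? [? ?]] := bnds; apply/andP; split; lra.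
Qed.

(** Only the limit in [X] is bounded, by [wnormF']; the [1] is slack at finite [X], from a threshold
    depending on [K]. *)
Let wnormZ_near K : \forall X \near \oo, wnorm r K (Z X) <= C * A / r + 1.
Proof.
have h : (fun X => wnorm r K (Z X)) @ \oo --> wnorm r K (fun k => k.+1%:R * F k.+1).
  apply: (@cvg_sumr _ _ _ (fun (k : 'I_K) X => `|Z X k| * r ^+ k)) => k.
  by apply: cvgMl; apply: cvg_norm; exact: cvgZ.
have /cvgrPdist_lt/(_ 1 ltr01) := h; apply: filterS => X.
have := wnormF' K; rewrite ltr_norml => + /andP[+ _]; lra.
Qed.

(** Division by [F]: its constant term is at least [c] by the Euler product, and [rc] keeps the
    nonconstant part below [c / 2] at radius [r]. *)
Let wnormL K : \forall X \near \oo,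
  wnorm r K (L X) <= 2 / c * (C * A / r + 1 + 80 * (C * A)).
Proof.
apply: filterS (wnormZ_near K) => X hZ.
have hF0 : c <= F 0%N by exact: (dser_lower_bound f0 f1 f_le1 fM fB a12).
have hF : c <= `|F 0%N| by rewrite (le_trans hF0)// ler_norm.
have vt : wnorm r K F - `|F 0%N| <= c / 2.
  apply: le_trans rc; have [? ? d0 ? [? ?]] := bnds.
  have h1 : r <= d / 2 by lra.
  have h2 : 0 < d / 2 by lra.
  apply: le_trans (wnorm_tail K F (ltW r0) h1 h2) _.
  by apply: ler_wpM2l (wnormF K); apply: divr_ge0; apply: ltW.
apply: le_trans (wnorm_cauchy_prod_div (L X) (ltW r0) c0 hF vt) _.
rewrite ler_wpM2l ?divr_ge0 ?(ltW c0)//.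
rewrite (eq_wnorm _ _ (LFE X)) (le_trans (wnormD _ _ _ (ltW r0)))//.
by rewrite lerD.
Qed.

(** [D] differs from [- L] by the sum with weights [f p - e p], which is a formal derivative of a
    series with small partial sums. *)
Let wnormD_near K : \forall X \near \oo,
  wnorm r K (D X) <= C' * A / r + 2 / c * (C * A / r + 1 + 80 * (C * A)).
Proof.
apply: filterS (wnormL K) => X hL.
pose s p := if prime p then f p - e p else 0.
have DE k : D X k = k.+1%:R * series (fun n => s n * dphi a n k.+1) X + - L X k.
  rewrite /D /L /series/= mulr_sumr.
  have -> : \sum_(0 <= n < X) k.+1%:R * (s n * dphi a n k.+1) =
      \sum_(0 <= p < X | prime p) ln p%:R * (f p - e p) * dphi a p k.
    rewrite [RHS]big_mkcond; apply: eq_bigr => p _; rewrite /s.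
    case: ifP => _; last by rewrite mul0r mulr0.
    by rewrite mulrCA -dphiS; ring.
  by rewrite -sumrB; apply: eq_bigr => p _; ring.
rewrite (eq_wnorm _ _ DE) (le_trans (wnormD _ _ _ (ltW r0)))// wnormN lerD//.
apply: le_trans (wnorm_diff _ (fun k => series (fun n => s n * dphi a n k) X) r0) _.
rewrite ler_wpM2r ?invr_ge0 ?(ltW r0)//.
have a12' : 1 <= a <= 2 by case/andP: a12 => /ltW -> ->.
apply: le_trans (wnorm_abel K.+1 X d01 a12' eC).
by apply: wnorm_le; have [? ? ? ? [? ?]] := bnds; apply/andP; split; lra.
Qed.

Let D_ge0 X k : 0 <= D X k.
Proof.
apply: sumr_ge0 => p pp.
apply: mulr_ge0 (dphi_ge0 _ _ _).
by rewrite mulr_ge0 ?ln_nat_ge0 ?oppr_ge0 ?e_le0.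
Qed.

Let D_mono X Y k : (X <= Y)%N -> D X k <= D Y k.
Proof.
move=> XY; rewrite /D [leRHS](big_cat_nat (n := X))//= lerDl; apply: sumr_ge0 => p pp.
apply: mulr_ge0 (dphi_ge0 _ _ _).
by rewrite mulr_ge0 ?ln_nat_ge0 ?oppr_ge0 ?e_le0.
Qed.

(** The sign of [e] makes [D] nondecreasing in [X], so a bound for large [X] holds for every [X],
    whatever the threshold attached to [K]. *)
Let wnorm_D X K :
  wnorm r K (D X) <= C' * A / r + 2 / c * (C * A / r + 1 + 80 * (C * A)).
Proof.
have [N _ hN] := wnormD_near K.
apply: le_trans (hN (maxn X N) (leq_maxr _ _)).
apply: ler_sum => k _; rewrite !ger0_norm// ler_wpM2r ?exprn_ge0 ?(ltW r0)//.
by rewrite D_mono// leq_maxl.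
Qed.

(** As [K] grows, the norm of [D X], a sum of nonnegative terms, tends to the value of the truncated
    series at the point [a - r]. The factor [ln p] is then bounded below by [ln 2]. *)
Lemma prime_sum_bound X :
  \sum_(0 <= p < X | prime p) - e p * p%:R `^ (r - a) <=
  (C' * A / r + 2 / c * (C * A / r + 1 + 80 * (C * A))) / ln 2.
Proof.
have ln2 : 0 < ln 2 :> R by rewrite ln_gt0// ltr1n.
rewrite ler_pdivlMr//.
apply: (@le_trans _ _ (\sum_(0 <= p < X | prime p) ln p%:R * (- e p) * p%:R `^ (r - a))).
  rewrite mulr_suml; apply: ler_sum => p pp.
  rewrite [leLHS](_ : _ = ln 2 * (- e p * p%:R `^ (r - a))); last by ring.
  rewrite -mulrA ler_wpM2r ?mulr_ge0 ?powR_ge0 ?oppr_ge0 ?e_le0//.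
  by rewrite ler_ln ?posrE ?ltr0n ?prime_gt0// ler_nat prime_gt1.
have cv : (fun K => wnorm r K (D X)) @ \oo -->
   \sum_(0 <= p < X | prime p) ln p%:R * (- e p) * p%:R `^ (r - a).
  pose v p K := if prime p then
    ln p%:R * (- e p) * p%:R `^ (- a) * series (exp_coeff (r * ln p%:R)) K else 0.
  have -> : (fun K => wnorm r K (D X)) = (fun K => \sum_(0 <= p < X) v p K).
    apply/funext => K; rewrite /wnorm.
    under eq_bigr do rewrite (ger0_norm (D_ge0 _ _)) /D mulr_suml.
    rewrite exchange_big/= [LHS]big_mkcond/=; apply: eq_bigr => p _; rewrite /v.
    case: ifP => // _; rewrite /series/= big_mkord mulr_sumr; apply: eq_bigr => k _.
    by rewrite /dphi /exp_coeff/= exprMn; ring.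
  rewrite [X in _ --> X]big_mkcond/=.
  apply: (@cvg_sumr _ _ _ v) => p; rewrite /v.
  case: ifPn => pp; last exact: cvg_cst.
  rewrite (_ : r - a = - a + r); last by rewrite addrC.
  rewrite powR_natD ?prime_gt0// mulrA; apply: cvgMr.
  by rewrite powR_natE ?prime_gt0//; exact: is_cvg_series_exp_coeff.
by apply: (cvgr_to_le cv); near=> K.
Unshelve. all: by end_near. Qed.

End FixedExponent.

(* Landau's argument: the Taylor coefficients at [a] of [sum - e p p^(-s)] are
   nonnegative and bounded uniformly in [a > 1] by a geometric sequence of
   ratio [1 / r], so the series converges to the left of [s = 1]. *)
Lemma landau : exists alpha : R, 0 < alpha < 4^-1 /\
  cvgn (series (fun p => if prime p then e p * p%:R `^ (- (1 - alpha)) else 0)).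
Proof.
case/andP: (d_bnd) => d0 d4.
(* Chosen so that [q * (C * A + 1) = c / 2]; the added [1] keeps the denominator positive. Below,
   [m <= 1 / 2] ensures [r <= d / 4] and [m <= q] ensures [rc]. *)
pose q := c / (2 * (C * A + 1)).
have CA1 : 0 < C * A + 1 by rewrite ltr_wpDl.
have q0 : 0 < q by rewrite divr_gt0// mulr_gt0.
pose m := Num.min (2^-1) q.
have m0 : 0 < m by rewrite lt_min q0 andbT; lra.
have m2 : m <= 2^-1 by rewrite ge_min lexx.
have mq : m <= q by rewrite ge_min lexx orbT.
pose r := m * (d / 2).
have r0 : 0 < r by rewrite mulr_gt0//; lra.
have rd : r <= d / 4.
  have : m * (d / 2) <= 2^-1 * (d / 2) by rewrite ler_wpM2r//; lra.
  rewrite /r; lra.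
have rc : r / (d / 2) * (C * A) <= c / 2.
  rewrite /r mulfK; last by rewrite gt_eqF//; lra.
  apply: (@le_trans _ _ (q * (C * A + 1))).
    by apply: ler_pM; rewrite ?(ltW m0)// lerDl.
  by rewrite /q invfM mulrA divfK// gt_eqF.
(* Taking [a = 1 + r / 2], closer to [1] than the radius [r], the point reached is
   [a - r = 1 - r / 2], hence the exponent [r / 2]. *)
have a12 : 1 < 1 + r / 2 <= 2 by apply/andP; split; lra.
exists (r / 2); split; first by apply/andP; split; lra.
have h := prime_sum_bound r0 rd rc a12.
have -> : (fun p => if prime p then e p * p%:R `^ (- (1 - r / 2)) else 0) =
  - (fun p => if prime p then - e p * p%:R `^ (- (1 - r / 2)) else 0).
  apply/funext => p; rewrite -[RHS]/(- (if prime p then _ else _)).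
  by case: ifP; rewrite ?oppr0// mulNr opprK.
rewrite is_cvg_seriesN; apply: nondecreasing_is_cvgn.
  apply: nondecreasing_series => p _ _; case: ifP => // pp.
  by rewrite mulr_ge0 ?powR_ge0 ?oppr_ge0 ?e_le0.
exists ((C' * A / r + 2 / c * (C * A / r + 1 + 80 * (C * A))) / ln 2) => _ [X _ <-].
rewrite (le_trans _ (h X))// /series/= [leRHS]big_mkcond/=; apply: ler_sum => p _.
by case: ifP => // _; rewrite (_ : - (1 - r / 2) = r - (1 + r / 2))//; field.
Qed.

End Landau.

(** * Almost sure bound for sums of uncorrelated variables *)

Section UncorrelatedSums.
Context (d : measure_display) (T : measurableType d) (R : realType) (P : probability T R).

Lemma Lfun_bounded (X : T -> R) (M r : R) : measurable_fun setT X -> 0 <= r ->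
  (forall w, `|X w| <= M) -> X \in Lfun P r%:E.
Proof.
move=> mX r0 XM; rewrite inE/=; apply/andP; split; rewrite inE//=.
rewrite /finite_norm unlock poweR_lty//.
apply: (@le_lt_trans _ _ (\int[P]_x (M `^ r)%:E)%E); last first.
  by rewrite integral_cst//= probability_setT mule1 ltry.
apply: ge0_le_integral => //.
- by move=> x _; rewrite lee_fin powR_ge0.
- apply/measurable_EFinP; apply: (measurableT_comp (measurable_powR _)) => //.
  exact: measurableT_comp.
- move=> x _; rewrite lee_fin ge0_ler_powR// nnegrE.
  exact: le_trans (XM x).
Qed.

Variable X : nat -> T -> R.
Hypothesis mX : forall n, measurable_fun setT (X n).
Hypothesis X_le1 : forall n w, `|X n w| <= 1.
Hypothesis X_uncorr : forall m n, m != n -> covariance P (X m) (X n) = 0%E.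

Let e n : R := fine ('E_P[X n])%E.
Let S N : T -> R := \sum_(0 <= k < N) X k.
Let U N w : R := \sum_(0 <= k < N) (X k w - e k).

Let X2 n : X n \in Lfun P 2%:E. Proof. exact: (@Lfun_bounded _ 1). Qed.

Let X1 n : X n \in Lfun P 1. Proof. exact: (@Lfun_bounded _ 1 1). Qed.

Let S2 N : S N \in Lfun P 2%:E.
Proof. by rewrite rpred_sum ?lee1n. Qed.

Let S1 N : S N \in Lfun P 1. Proof. by rewrite rpred_sum. Qed.

Let SS N : S N.+1 = (S N \+ X N)%R.
Proof. by rewrite /S big_nat_recr. Qed.

Let expectS N : ('E_P[S N] = (\sum_(0 <= k < N) e k)%:E)%E.
Proof.
elim: N => [|N IH].
  by rewrite /S !big_geq//; exact: expectation_cst.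
rewrite SS expectationD// IH big_nat_recr//= EFinD; congr (_ + _)%E.
by rewrite fineK// expectation_fin_num.
Qed.

Let covS M N : (M <= N)%N -> (covariance P (S M) (X N) = 0)%E.
Proof.
elim: M => [_|M IH MN].
  by rewrite /S big_geq//; exact: covariance_cst_l.
by rewrite SS covarianceDl// IH ?(ltnW MN)// add0e X_uncorr// ltn_eqF.
Qed.

Let varX n : (variance P (X n) <= 1)%E.
Proof.
rewrite varianceE// leeBlDr ?fin_numX ?expectation_fin_num//.
rewrite (@le_trans _ _ 1%E)//; last first.
  by rewrite leeDl// sqre_ge0.
rewrite -[leRHS](expectation_cst P 1).
have -> : X n ^+ 2 = (fun w => X n w ^+ 2) by apply/funext => w; rewrite expr2.
apply: expectation_le => //.
- exact: measurable_funX.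
- by move=> w; rewrite /= sqr_ge0.
- apply: aeW => w /=.
  by rewrite -real_normK ?num_real// expr_le1.
Qed.

Let varS N : (variance P (S N) <= N%:R%:E)%E.
Proof.
elim: N => [|N IH].
  by rewrite /S big_geq//; rewrite (_ : variance _ _ = 0%E)//; exact: variance_cst.
rewrite SS varianceD// covS// mule0 adde0 -natr1 EFinD leeD//.
Qed.

Let integralU N : (\int[P]_w ((U N w ^+ 2)%:E) <= N%:R%:E)%E.
Proof.
apply: le_trans (varS N); rewrite /variance unlock expectS/= unlock.
rewrite le_eqVlt; apply/orP; left; apply/eqP/eq_integral => w _; congr EFin.
rewrite -expr2; congr (_ ^+ 2).
by rewrite /U /S sumrB fct_sumE.
Qed.

Let mU N : measurable_fun setT (U N).
Proof.
apply: measurable_sum => k; apply: measurable_funB => //.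
Qed.

(** The variance of [U (k ^ 4)] is at most [k ^ 4], so the weight [k ^ (- 6)] leaves expectation at
    most [k ^ (- 2)], which is summable. *)
Let Y k w : \bar R := (U (k ^ 4) w ^+ 2 * k%:R `^ (- 6))%:E.

Let Y0 k w : (0 <= Y k w)%E.
Proof. by rewrite lee_fin mulr_ge0 ?powR_ge0 ?sqr_ge0. Qed.

Let mY k : measurable_fun setT (Y k).
Proof.
by apply/measurable_EFinP; apply: measurable_funM => //; exact: measurable_funX.
Qed.

Let integralY k : (\int[P]_w (Y k w) <= (k%:R `^ (- 1 - 1))%:E)%E.
Proof.
rewrite /Y; under eq_integral do rewrite EFinM.
rewrite ge0_integralZr//; last 2 first.
- by apply/measurable_EFinP; exact: measurable_funX.
- by move=> *; rewrite lee_fin sqr_ge0.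
apply: (@le_trans _ _ ((k ^ 4)%:R%:E * (k%:R `^ (- 6))%:E)%E).
  by rewrite lee_wpmul2r ?lee_fin ?powR_ge0.
rewrite -EFinM lee_fin; case: k => [|k].
  by rewrite powR0 ?mulr0 ?powR_ge0// oppr_eq0.
rewrite natrX -powR_mulrn// -powR_natD// ler_powR_nat//; lra.
Qed.

Let sumY_fin : {ae P, forall w, (\sum_(k <oo) Y k w)%E \is a fin_num}.
Proof.
have : P.-integrable setT (fun w => \sum_(k <oo) Y k w)%E.
  apply/integrableP; split.
    by apply: ge0_emeasurable_sum => //.
  under eq_integral do rewrite gee0_abs ?nneseries_ge0//.
  rewrite integral_nneseries//.
  apply: (@le_lt_trans _ _ 2%:E); last exact: ltry.
  apply: lime_le; first by apply: is_cvg_nneseries => k _ _; exact: integral_ge0.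
  near=> n.
  apply: (@le_trans _ _ (\sum_(0 <= k < n) (k%:R `^ (- 1 - 1))%:E)%E).
    by apply: lee_sum => k _; exact: integralY.
  rewrite sumEFin lee_fin.
  by have := @series_powR_le R 1 n ltr01; rewrite invr1.
move/integrable_ae => /(_ measurableT); apply: filterS => w; exact.
Unshelve. all: by end_near. Qed.

(** A finite sum of the [Y k] bounds each of them, so [U (k ^ 4)] is [O(k ^ 3)], that is, the power
    [3 / 4] of [k ^ 4]. Between consecutive fourth powers there are [O(k ^ 3)] bounded terms. *)
Lemma ae_uncorrelated_sum_le : {ae P, forall w, exists C : R,
  forall n, `|\sum_(0 <= k < n.+1) (X k w - fine ('E_P[X k])%E)|
    <= C * n.+1%:R `^ (3 / 4)}.
Proof.
apply: filterS sumY_fin => w hfin.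
pose M := fine (\sum_(k <oo) Y k w)%E.
have M0 : 0 <= M by rewrite fine_ge0// nneseries_ge0.
have YM k : (Y k w <= M%:E)%E.
  rewrite fineK//; apply: le_trans (nneseries_lim_ge k.+1 _) => //.
  by rewrite big_nat_recr//= leeDr// sume_ge0.
have UM k : (0 < k)%N -> `|U (k ^ 4) w| <= Num.sqrt M * k%:R ^+ 3.
  move=> k0; have := YM k; rewrite lee_fin powRN -/(_ / _) ler_pdivrMr; last first.
    by apply: powR_gt0; rewrite ltr0n.
  rewrite powR_mulrn// => h.
  rewrite -sqrtr_sqr (le_trans (ler_wsqrtr h))// sqrtrM//.
  by rewrite (_ : _ ^+ 6 = (k%:R ^+ 3) ^+ 2) ?sqrtr_sqr ?ger0_norm ?exprn_ge0// -exprM.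
have e1 k : `|e k| <= 1.
  rewrite /e -lee_fin -abse_EFin fineK ?expectation_fin_num//.
  rewrite unlock (le_trans (le_abse_integral _ _ _))//; first exact/measurable_EFinP.
  apply: (@le_trans _ _ (\int[P]_x 1%:E)%E); last by rewrite integral_cst//= probability_setT mule1.
  apply: ge0_le_integral => //.
  - by apply/measurable_EFinP; exact: measurableT_comp.
  - by move=> x _; rewrite lee_fin X_le1.
exists (Num.sqrt M + 30) => n.
have [k [k0 kn nk]] : exists k, [/\ (0 < k)%N, (k ^ 4 <= n.+1)%N & (n.+1 < k.+1 ^ 4)%N].
  have ex : exists k, (k ^ 4 <= n.+1)%N by exists 1%N.
  have bd k : (k ^ 4 <= n.+1)%N -> (k <= n.+1)%N.
    by case: k => // k; apply: leq_trans; rewrite -{1}(expn1 k.+1) leq_pexp2l.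
  case: (ex_maxnP ex bd) => k hk hmax; exists k; split=> //.
    by apply: hmax; rewrite exp1n.
  by rewrite ltnNge; apply/negP => /hmax; rewrite ltnn.
rewrite -/(U n.+1 w).
have -> : U n.+1 w = U (k ^ 4) w + \sum_(k ^ 4 <= j < n.+1) (X j w - e j).
  by rewrite /U (big_cat_nat (n := (k ^ 4)%N)).
(* Each term is at most [2], and there are at most [(4 + 6 + 4 + 1) * k ^ 3] of them. *)
have h2 : `|\sum_(k ^ 4 <= j < n.+1) (X j w - e j)| <= 30 * k%:R ^+ 3.
  apply: (@le_trans _ _ (\sum_(k ^ 4 <= j < n.+1) 2)).
    rewrite (le_trans (ler_norm_sum _ _ _))//; apply: ler_sum => j _.
    by rewrite (le_trans (ler_normB _ _))// (_ : 2 = 1 + 1) ?lerD.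
  rewrite big_const_nat iter_addr_0 -[leLHS]mulr_natr -!natrX -!natrM ler_nat.
  have : (n.+1 - k ^ 4 <= k.+1 ^ 4 - k ^ 4)%N by rewrite leq_sub2r// ltnW.
  move=> h; apply: (@leq_trans (2 * (k.+1 ^ 4 - k ^ 4))); first by rewrite leq_mul2l.
  have E : (k.+1 ^ 4 = k ^ 4 + (4 * k ^ 3 + 6 * k ^ 2 + 4 * k + 1))%N.
    by rewrite -addn1 !expnS !expn0; ring.
  have k2 : (k ^ 2 <= k ^ 3)%N by rewrite leq_pexp2l.
  have k1 : (k <= k ^ 3)%N by rewrite -{1}(expn1 k) leq_pexp2l.
  have k3 : (0 < k ^ 3)%N by rewrite expn_gt0 k0.
  by rewrite E addKn; move: k2 k1 k3; move: (k ^ 2)%N (k ^ 3)%N => *; lia.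
rewrite (le_trans (ler_normD _ _))// (le_trans (lerD (UM k k0) h2))// -mulrDl.
rewrite ler_wpM2l ?addr_ge0 ?sqrtr_ge0//.
have -> : k%:R ^+ 3 = (k ^ 4)%:R `^ (3 / 4) :> R.
  by rewrite natrX -!powR_mulrn// -powRrM; congr (_ `^ _); field.
by rewrite ge0_ler_powR ?nnegrE ?ler_nat//; lra.
Qed.

End UncorrelatedSums.

(** * From the random function to the deterministic hypotheses *)

Section RandomMultiplicative.
Context (d : measure_display) (T : measurableType d) (R : realType)
  (P : probability T R) (f : nat -> {RV P >-> R}).
Hypothesis f_mult : random_multiplicative f.

Lemma rm_sign_indic p : prime p ->
  (f p : T -> R) = ((2 \o* \1_(f p @^-1` [set 1])) \- cst 1)%R.
Proof.
move=> pp; apply/funext => w; rewrite /= indicE.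
have [fw|fw] := rm_prime f_mult w pp; last by rewrite mem_set//= fw; ring.
rewrite memNset//= fw; first by ring.
by move=> h; have := ltrN10 R; rewrite h ltNge ler01.
Qed.

(** Independence speaks of events, so each sign is written [2 * 1_A - 1] and the product expanded
    into indicators. *)
Lemma rm_uncorrelated p q : prime p -> prime q -> p != q ->
  covariance P (f p) (f q) = 0%E.
Proof.
move=> pp pq npq.
pose A := f p @^-1` [set 1]; pose B := f q @^-1` [set 1].
have mA : measurable A by rewrite -[A]setTI; exact: measurable_funP.
have mB : measurable B by rewrite -[B]setTI; exact: measurable_funP.
have PAB : (P (A `&` B) = P A * P B)%E.
  have := rm_indep f_mult (J := (p |` [fset q])%fset) (B := fun=> [set 1]).
  rewrite big_fsetU1 ?inE// big_seq_fset1 => <- //; last first.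
    by move=> i /=; rewrite !inE => /orP[]/eqP ->.
  congr (P _); apply/seteqP; split => w /=.
    by move=> [Aw Bw] i /=; rewrite !inE => /orP[]/eqP ->.
  by move=> h; split; apply: h; rewrite /= !inE eqxx ?orbT.
have bound n w : prime n -> `|f n w| <= 1.
  by move=> /(rm_prime f_mult w)[] ->; rewrite ?normrN normr1.
have L2 n : prime n -> (f n : T -> R) \in Lfun P 2%:E.
  by move=> pn; apply: (@Lfun_bounded _ _ _ _ _ 1) => // w; exact: bound.
have L1 n : prime n -> (f n : T -> R) \in Lfun P 1.
  by move=> pn; apply: (@Lfun_bounded _ _ _ _ _ 1 1) => // w; exact: bound.
have LI (C : set T) : measurable C -> (\1_C : T -> R) \in Lfun P 1.
  move=> mC; apply: (@Lfun_bounded _ _ _ _ _ 1 1) => // w.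
  by rewrite indicE; case: (_ \in _); rewrite ?normr0 ?normr1.
have LZ (C : set T) k : measurable C -> (k \o* \1_C : T -> R) \in Lfun P 1.
  by move=> mC; apply: Lfun_scale => //; exact: LI.
have EZ (C : set T) k : measurable C -> ('E_P[k \o* \1_C] = k%:E * P C)%E.
  by move=> mC; rewrite expectationZl ?LI// expectation_indic.
have LC k : (cst k : T -> R) \in Lfun P 1 by exact: Lfun_cst.
rewrite covarianceE ?L1//; last by apply: Lfun2_mul_Lfun1; exact: L2.
have -> : ((f p : T -> R) * (f q : T -> R))%R =
    (((4 \o* \1_(A `&` B)) \- (2 \o* \1_A)) \- (2 \o* \1_B)) \+ cst 1.
  rewrite (rm_sign_indic pp) (rm_sign_indic pq) -/A -/B; apply/funext => w.
  by rewrite -[LHS]/(_ w * _ w) /= indicI/=; ring.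
rewrite (rm_sign_indic pp) (rm_sign_indic pq) -/A -/B.
have mAB := measurableI _ _ mA mB.
rewrite expectationD//= ?rpredB ?LZ// !expectationB ?rpredB ?LZ// !EZ// !expectation_cst PAB.
have -> : P A = (fine (P A))%:E by rewrite fineK ?fin_num_measure.
have -> : P B = (fine (P B))%:E by rewrite fineK ?fin_num_measure.
set x := fine (P A); set y := fine (P B).
rewrite -[LHS]/((4 * (x * y) - 2 * x - 2 * y + 1 - (2 * x - 1) * (2 * y - 1))%:E).
by congr EFin; ring.
Qed.

Let X p : T -> R := if prime p then f p else cst 0.

Let e p : R := fine ('E_P[X p])%E.

Lemma ae_rm_prime_sum_le : {ae P, forall w, exists C : R,
  forall n, `|series (fun p => if prime p then f p w - fine ('E_P[f p])%E else 0) n.+1|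
    <= C * n%:R `^ (3 / 4)}.
Proof.
have mX n : measurable_fun setT (X n) by rewrite /X; case: ifP.
have X1 n w : `|X n w| <= 1.
  rewrite /X; case: ifPn => pn; last by rewrite /= normr0.
  by have [->|->] := rm_prime f_mult w pn; rewrite ?normrN normr1.
have Xu m n : m != n -> covariance P (X m) (X n) = 0%E.
  move=> mn; rewrite /X; case: ifPn => pm; last exact: covariance_cst_l.
  case: ifPn => pn; last exact: covariance_cst_r.
  exact: rm_uncorrelated.
apply: filterS (ae_uncorrelated_sum_le mX X1 Xu) => w [C hC].
have C0 : 0 <= C.
  by have := hC 0%N; rewrite powR1 mulr1; apply: le_trans.
exists (2 * C) => -[|n].
  by rewrite /series/= big_nat1 normr0 !mulr_ge0 ?powR_ge0.
rewrite [series _ _](_ : _ = \sum_(0 <= k < n.+2) (X k w - e k)); last first.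
  apply: eq_bigr => k _; rewrite /e /X; case: ifP => // _.
  by rewrite expectation_cst/= subrr.
(* Passing from [n.+2] to [n.+1] in the power costs a factor of at most [2]. *)
apply: le_trans (hC n.+1) _; rewrite (mulrC 2) -mulrA ler_wpM2l//.
rewrite (le_trans (powR_succ_le _ _))//; first by apply/andP; split; lra.
rewrite mulrC ler_wpM2r ?powR_ge0//.
have : n.+1%:R^-1 <= 1 :> R by rewrite invf_le1 ?ltr0n ?ler1n.
by move: (n.+1%:R^-1) => x; lra.
Qed.

(* The dummy value [f 0] is normalised to [0]. *)
Definition rm_path (w : T) (n : nat) : R := if n == 0%N then 0 else f n w.

Lemma rm_pathE w n : (0 < n)%N ->
  rm_path w n = (squarefree n)%:R * \prod_(p <- primes n) f p w.
Proof.
move=> n0; rewrite /rm_path gtn_eqF//.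
case: n n0 => [//|[_|n _]].
  by rewrite (rm_1 f_mult) big_nil mulr1.
rewrite (rm_mult f_mult)// /moebius; congr (_ * _); case: ifP => _; last by rewrite normr0.
by rewrite normrX normrN normr1 expr1n.
Qed.

Lemma primes_mul_perm p m : prime p -> (0 < m)%N -> ~~ (p %| m)%N ->
  perm_eq (primes (p * m)) (p :: primes m).
Proof.
move=> pp m0 pm; have p0 := prime_gt0 pp.
apply: uniq_perm; first exact: primes_uniq.
  by rewrite /= primes_uniq andbT mem_primes pp m0.
by move=> q; rewrite primesM// inE primes_prime// inE.
Qed.

Lemma squarefree_mul p m : prime p -> (0 < m)%N ->
  squarefree (p * m) = ~~ (p %| m)%N && squarefree m.
Proof.
move=> pp m0; have p0 := prime_gt0 pp.
have [pm|pm] /= := boolP (p %| m)%N.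
  rewrite /squarefree muln_gt0 p0 m0/=; apply/negP => /allP/(_ p).
  rewrite primesM// primes_prime// mem_seq1 eqxx => /(_ isT).
  rewrite lognM// logn_prime// eqxx add1n eqSS.
  by rewrite -leqn0 leqNgt logn_gt0 mem_primes pp m0 pm.
rewrite /squarefree muln_gt0 p0 m0/= (perm_all _ (primes_mul_perm pp m0 pm))/=.
rewrite lognM// logn_prime// eqxx (_ : logn p m = 0%N) ?eqxx/=; last first.
  by apply/eqP; rewrite -leqn0 leqNgt logn_gt0 mem_primes pp m0 (negbTE pm).
apply: eq_in_all => q; rewrite mem_primes => /and3P[pq _ qm].
rewrite lognM// logn_prime// (_ : (q == p) = false)//.
by apply/eqP => qp; rewrite -qp qm in pm.
Qed.

Lemma rm_pathM w p m : prime p -> (0 < m)%N ->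
  rm_path w (p * m)%N = if (p %| m)%N then 0 else rm_path w p * rm_path w m.
Proof.
move=> pp m0; have p0 := prime_gt0 pp.
rewrite rm_pathE ?muln_gt0 ?p0// squarefree_mul//.
have [pm|pm] /= := boolP (p %| m)%N; first by rewrite mul0r.
rewrite (perm_big _ (primes_mul_perm pp m0 pm))/= big_cons (rm_pathE _ m0).
by rewrite /rm_path gtn_eqF//; ring.
Qed.

Lemma rm_path_le1 w n : `|rm_path w n| <= 1.
Proof.
rewrite /rm_path; case: eqP => [_|/eqP n0]; first by rewrite normr0.
have [] := rm_range f_mult w (n := n); first by rewrite lt0n.
all: by move=> ->; rewrite ?normrN ?normr0 ?normr1.
Qed.

Lemma partial_sum_nat w n : partial_sum f w n%:R = series (rm_path w) n.+1.
Proof.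
rewrite /partial_sum natrK /series/= [RHS]big_nat_recl//= {1}/rm_path eqxx add0r.
by rewrite big_add1.
Qed.

(** The asymptotic bound holds for [n > M]; for smaller [n] the trivial bound [n] is at most [M] and
    is absorbed in the constant. *)
Lemma rm_path_sum_le w (delta t : R) : 0 < t <= delta -> delta < 1 ->
  partial_sum f w =o_+oo (fun x : R => x `^ (1 - delta)) ->
  exists C, forall n, `|series (rm_path w) n.+1| <= C * n%:R `^ (1 - t).
Proof.
move=> /andP[t0 td] d1 /eqoP/(_ 1 ltr01)[M [_ hM]].
exists (1 + `|M|) => -[|n].
  by rewrite /series/= big_nat1 /rm_path eqxx normr0 mulr_ge0 ?powR_ge0.
have p1 : 1 <= n.+1%:R `^ (1 - t) :> R.
  by rewrite -[leLHS](powRr0 n.+1%:R) ler_powR_nat//; lra.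
have [Mn|nM] := ltP M n.+1%:R.
  have := hM _ Mn; rewrite mul1r partial_sum_nat (ger0_norm (powR_ge0 _ _)).
  move=> h; apply: le_trans h _.
  rewrite -[leLHS]mul1r ler_pM ?powR_ge0 ?lerDl// ler_powR_nat//; lra.
apply: (@le_trans _ _ (n.+1%:R)).
  rewrite /series/= big_nat_recl// {1}/rm_path eqxx add0r.
  rewrite (le_trans (ler_norm_sum _ _ _))//.
  rewrite (le_trans (ler_sum _ (fun i _ => rm_path_le1 w i.+1)))//.
  by rewrite big_const_nat subn0 iter_addr_0.
rewrite (le_trans nM)// (le_trans (ler_norm M))//.
rewrite (@le_trans _ _ (1 + `|M|)) ?lerDr// ler_peMr// addr_ge0//.
Qed.

End RandomMultiplicative.

(** * The exponent from one path, the convergence for almost all *)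

Unset Implicit Arguments.
Theorem theorem1p3 (d : measure_display) (T : measurableType d)
    (R : realType) (P : probability T R) (f : nat -> {RV P >-> R})
    (f_mult : random_multiplicative f) (f_wb : weakly_biased f)
    (f_small : {ae P, forall w, exists delta : R,
       [/\ 0 < delta, delta < 1 / 2 &
           partial_sum f w =o_+oo (fun x : R => x `^ (1 - delta))]}) :
  exists alpha : R,
    [/\ 0 < alpha, alpha < 1 / 2 &
        {ae P, forall w,
           prime_series_cvg (fun p : nat => f p w / p%:R `^ (1 - alpha))}].
Proof.
have [f_bias f_cvg] := f_wb.
pose e p := fine ('E_P[f p])%E.
have e_le0 p : prime p -> e p <= 0.
  by move=> pp; rewrite fine_le0// ltW// f_bias.
have f_sum := ae_rm_prime_sum_le f_mult.
have [alpha [/andP[a0 a4] ce]] : exists alpha : R, 0 < alpha < 4^-1 /\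
    cvgn (series (fun p => if prime p then e p * p%:R `^ (- (1 - alpha)) else 0)).
  have PF : ProperFilter (almost_everywhere P).
    have P0 : (0 < P setT)%E by rewrite probability_setT lte01.
    exact: ae_properfilter_algebraOfSetsType P0.
  (* One sample point lies in all three almost sure events. The series obtained from it has
     coefficients [e p], so [alpha] then serves for almost every path. *)
  have [w [[[delta [d0 d2 fo]] fc] [C' hC']]] := filter_ex (filterI (filterI f_small f_cvg) f_sum).
  (* With [t <= 1 / 4], the bound [n ^ (3 / 4)] for the centred sums is also a bound [n ^ (1 - t)],
     so one exponent fits both hypotheses. *)
  pose t := Num.min delta 4^-1.
  have t0 : 0 < t by rewrite lt_min d0/=; lra.
  have t4 : t <= 4^-1 by rewrite ge_min lexx orbT.
  have td : 0 < t <= delta by rewrite t0 ge_min lexx.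
  have d1 : delta < 1 by lra.
  have [C fC] := rm_path_sum_le f_mult td d1 fo.
  have C'0 : 0 <= C' by have := hC' 1%N; rewrite powR1 mulr1; apply: le_trans.
  have pathE p : prime p -> rm_path f w p = f p w.
    by move=> pp; rewrite /rm_path gtn_eqF// prime_gt0.
  have [B hB] := cvg_has_ub fc.
  apply: (@landau R (rm_path f w) e _ _ _ _ e_le0 C C' t B).
  - by [].
  - by rewrite /rm_path/= (rm_1 f_mult).
  - exact: rm_path_le1.
  - by move=> p m; exact: rm_pathM.
  - by rewrite t0.
  - exact: fC.
  - move=> n; rewrite [series _ _](_ : _ =
        series (fun p => if prime p then f p w - e p else 0) n.+1); last first.
      by apply: eq_bigr => p _; case: ifPn => // pp; rewrite pathE.
    apply: le_trans (hC' n) _; rewrite ler_wpM2l//; case: n => [|n].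
      by rewrite !powR0// gt_eqF//; lra.
    by rewrite ler_powR_nat//; lra.
  - move=> X; rewrite [series _ _](_ : _ =
        series (fun p => if prime p then f p w / p%:R else 0) X); last first.
      by apply: eq_bigr => p _; case: ifPn => // pp; rewrite pathE.
    by apply: hB; exists X.
exists alpha; split => //; first lra.
apply: filterS f_sum => w [C hC]; rewrite /prime_series_cvg.
have h4 : 0 < (4^-1 : R) < 1 by apply/andP; split; lra.
(* The bound [alpha < 1 / 4] puts the exponent above [3 / 4], within reach of [abel_cvg] for the
   centred part. *)
have hs : 1 - 4^-1 < 1 - alpha by lra.
have hC4 n : `|series (fun p => if prime p then f p w - e p else 0) n.+1| <= C * n%:R `^ (1 - 4^-1).
  by rewrite (_ : 1 - 4^-1 = 3 / 4)//; lra.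
have cu := abel_cvg h4 hs hC4.
have -> : (fun p => if prime p then f p w / p%:R `^ (1 - alpha) else 0) =
  (fun p => (if prime p then f p w - e p else 0) * p%:R `^ (- (1 - alpha))) +
  (fun p => if prime p then e p * p%:R `^ (- (1 - alpha)) else 0).
  apply/funext => p; rewrite -[RHS]/(_ * _ + if prime p then _ else _).
  case: ifP => _; last by rewrite mul0r addr0.
  by rewrite -powRN; ring.
exact: is_cvg_seriesD.
Qed.
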